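(* Let $\omega$ be a free ultrafilter on $\mathbb{N}$ and let $\theta$ be an automorphism of a $\mathrm{II}_1$ factor $\mathcal{M}$. If the ultrapower automorphism $\theta^\omega$ of $\mathcal{M}^\omega$ is inner, then $\theta$ is inner.
   Context: A $\mathrm{II}_1$ factor $\mathcal{M}$ (no cardinality or separability assumption) has a unique tracial state $\tau$; set $\|x\|_2=\sqrt{\tau(x^*x)}$. Automorphisms are *-automorphisms; an automorphism is inner if it equals $\mathrm{Ad}(u): x\mapsto uxu^*$ for some unitary $u$ in the algebra. Tracial ultrapower: $\ell^\infty(\mathcal{M})$ is the algebra of norm-bounded sequences in $\mathcal{M}$, $\mathcal{I}_\omega=\{(x_j)\in\ell^\infty(\mathcal{M}) : \lim_{j\to\omega}\|x_j\|_2=0\}$, and $\mathcal{M}^\omega=\ell^\infty(\mathcal{M})/\mathcal{I}_\omega$, which is a $\mathrm{II}_1$ factor. $\theta^\omega$ is the automorphism of $\mathcal{M}^\omega$ sending the class of $(x_j)$ to the class of $(\theta(x_j))$. *)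

(* Defs.v *)
From HB Require Import structures.
From mathcomp Require Import all_boot all_order all_algebra.
From mathcomp Require Import complex.
From mathcomp Require Import all_classical all_reals all_analysis.

Set Implicit Arguments.
Unset Strict Implicit.
Unset Printing Implicit Defensive.

Import Order.TTheory GRing.Theory Num.Theory numFieldNormedType.Exports.

Local Open Scope classical_set_scope.
Local Open Scope complex_scope.
Local Open Scope ring_scope.
Local Open Scope quotient_scope.

HB.mixin Record hasStar (C : numClosedFieldType) A of GRing.Algebra C A := {
  star : A -> A ;
  starK : involutive star ;
  starD : {morph star : x y / x + y} ;
  starM : forall x y : A, star (x * y) = star y * star x ;
  starZ : forall (c : C) (x : A), star (c *: x) = (c^*)%R *: star x
}.

#[short(type="starAlgType")]
HB.structure Definition StarAlgebra (C : numClosedFieldType) :=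
  {A of GRing.Algebra C A & hasStar C A}.

Section StarAlgebraTheory.
Variables (C : numClosedFieldType) (A : starAlgType C).
Implicit Types x y u : A.

Lemma star0 : star (0 : A) = 0.
Proof. by rewrite -(scale0r (0 : A)) starZ conjC0 !scale0r. Qed.

Lemma starN x : star (- x) = - star x.
Proof. by rewrite -scaleN1r starZ rmorphN rmorph1 scaleN1r. Qed.

Lemma starB x y : star (x - y) = star x - star y.
Proof. by rewrite starD starN. Qed.

Lemma star1 : star (1 : A) = 1.
Proof. by rewrite -[LHS]mul1r -{1}(starK 1) -starM mul1r starK. Qed.

Definition is_unitary u : Prop := star u * u = 1 /\ u * star u = 1.

Record is_star_aut (f : A -> A) : Prop := {
  star_aut_linear : linear f ;
  star_autM : {morph f : x y / x * y} ;
  star_aut_star : {morph f : x / star x} ;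
  star_aut_bij : bijective f
}.

Definition is_inner (f : A -> A) : Prop :=
  exists2 u, is_unitary u & forall x, f x = u * x * star u.

End StarAlgebraTheory.

Record starIdeal (C : numClosedFieldType) (A : starAlgType C) := StarIdeal {
  sideal_set :> A -> Prop ;
  sideal0 : sideal_set 0 ;
  sideal1 : ~ sideal_set 1 ;
  sidealD : forall x y, sideal_set x -> sideal_set y -> sideal_set (x + y) ;
  sidealMl : forall a x, sideal_set x -> sideal_set (a * x) ;
  sidealMr : forall a x, sideal_set x -> sideal_set (x * a) ;
  sideal_star : forall x, sideal_set x -> sideal_set (star x)
}.

Section StarQuotient.
Variables (C : numClosedFieldType) (A : starAlgType C) (I : starIdeal A).

Lemma sidealZ (c : C) x : I x -> I (c *: x).
Proof. by rewrite -[x]mul1r scalerAl mul1r; exact: sidealMl. Qed.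

Lemma sidealN x : I x -> I (- x).
Proof. by rewrite -scaleN1r; exact: sidealZ. Qed.

Lemma sidealB x y : I x -> I y -> I (x - y).
Proof. by move=> Ix Iy; apply: sidealD => //; exact: sidealN. Qed.

Definition sideal_rel : rel A := fun x y => `[< I (x - y) >].

Lemma sideal_rel_refl : reflexive sideal_rel.
Proof. by move=> x; apply/asboolP; rewrite subrr; exact: sideal0. Qed.

Lemma sideal_rel_sym : symmetric sideal_rel.
Proof.
move=> x y; rewrite /sideal_rel; apply/asboolP/asboolP => /sidealN;
  by rewrite opprB.
Qed.

Lemma sideal_rel_trans : transitive sideal_rel.
Proof.
move=> y x z /asboolP Ixy /asboolP Iyz; apply/asboolP.
by rewrite -(subrK y x) -addrA; exact: sidealD.
Qed.

Canonical sideal_equiv :=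
  EquivRel sideal_rel sideal_rel_refl sideal_rel_sym sideal_rel_trans.

Definition star_quot := {eq_quot sideal_rel}.
HB.instance Definition _ := EqQuotient.on star_quot.
HB.instance Definition _ := Choice.on star_quot.

Lemma star_quotP (x y : A) :
  reflect (I (x - y)) (\pi_star_quot x == \pi_star_quot y).
Proof. by rewrite eqquotE; apply: (iffP (asboolP _)). Qed.

Let squotW (P : star_quot -> Prop) :
  (forall x, P (\pi_star_quot x)) -> forall X, P X.
Proof. by move=> Px X; rewrite -[X]reprK. Qed.

Let piP (x y : A) : I (x - y) -> \pi_star_quot x = \pi_star_quot y.
Proof. by move=> /star_quotP/eqP. Qed.

Let reprP (x : A) : I (repr (\pi_star_quot x) - x).
Proof. by apply/star_quotP; rewrite reprK. Qed.

Definition squot_zero : star_quot := \pi_star_quot 0.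
Definition squot_one : star_quot := \pi_star_quot 1.
Definition squot_opp (X : star_quot) : star_quot := \pi_star_quot (- repr X).
Definition squot_add (X Y : star_quot) : star_quot := \pi_star_quot (repr X + repr Y).
Definition squot_mul (X Y : star_quot) : star_quot := \pi_star_quot (repr X * repr Y).
Definition squot_scale (c : C) (X : star_quot) : star_quot :=
  \pi_star_quot (c *: repr X).
Definition squot_star (X : star_quot) : star_quot := \pi_star_quot (star (repr X)).

Let pi_opp x : squot_opp (\pi_star_quot x) = \pi_star_quot (- x).
Proof. by apply: piP; rewrite -opprD; apply: sidealN; exact: reprP. Qed.

Let pi_add x y : squot_add (\pi_star_quot x) (\pi_star_quot y) = \pi_star_quot (x + y).
Proof.
by apply: piP; rewrite opprD addrACA; apply: sidealD; exact: reprP.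
Qed.

Let pi_mul x y : squot_mul (\pi_star_quot x) (\pi_star_quot y) = \pi_star_quot (x * y).
Proof.
apply: piP; set x' := repr _; set y' := repr _.
have -> : x' * y' - x * y = (x' - x) * y' + x * (y' - y).
  by rewrite mulrBl mulrBr addrA subrK.
by apply: sidealD; [apply: sidealMr | apply: sidealMl]; exact: reprP.
Qed.

Let pi_scale c x : squot_scale c (\pi_star_quot x) = \pi_star_quot (c *: x).
Proof. by apply: piP; rewrite -scalerBr; apply: sidealZ; exact: reprP. Qed.

Let pi_star x : squot_star (\pi_star_quot x) = \pi_star_quot (star x).
Proof. by apply: piP; rewrite -starB; apply: sideal_star; exact: reprP. Qed.

Let squot_addA : associative squot_add.
Proof.
by elim/squotW => x; elim/squotW => y; elim/squotW => z; rewrite !pi_add addrA.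
Qed.
Let squot_addC : commutative squot_add.
Proof. by elim/squotW => x; elim/squotW => y; rewrite !pi_add addrC. Qed.
Let squot_add0 : left_id squot_zero squot_add.
Proof. by elim/squotW => x; rewrite pi_add add0r. Qed.
Let squot_addN : left_inverse squot_zero squot_opp squot_add.
Proof. by elim/squotW => x; rewrite pi_opp pi_add addNr. Qed.

HB.instance Definition _ := GRing.isZmodule.Build star_quot
  squot_addA squot_addC squot_add0 squot_addN.

Let squot_mulA : associative squot_mul.
Proof.
by elim/squotW => x; elim/squotW => y; elim/squotW => z; rewrite !pi_mul mulrA.
Qed.
Let squot_mul1 : left_id squot_one squot_mul.
Proof. by elim/squotW => x; rewrite pi_mul mul1r. Qed.
Let squot_mulr1 : right_id squot_one squot_mul.
Proof. by elim/squotW => x; rewrite pi_mul mulr1. Qed.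
Let squot_mulDl : left_distributive squot_mul squot_add.
Proof.
elim/squotW => x; elim/squotW => y; elim/squotW => z.
by rewrite !(pi_add, pi_mul) mulrDl.
Qed.
Let squot_mulDr : right_distributive squot_mul squot_add.
Proof.
elim/squotW => x; elim/squotW => y; elim/squotW => z.
by rewrite !(pi_add, pi_mul) mulrDr.
Qed.

HB.instance Definition _ := GRing.Zmodule_isPzRing.Build star_quot
  squot_mulA squot_mul1 squot_mulr1 squot_mulDl squot_mulDr.

Let squot_neq0 : (1 : star_quot) != 0.
Proof. by apply/star_quotP; rewrite subr0; exact: sideal1. Qed.

HB.instance Definition _ :=
  GRing.PzSemiRing_isNonZero.Build star_quot squot_neq0.

Let squot_scaleA a b X :
  squot_scale a (squot_scale b X) = squot_scale (a * b) X.
Proof. by elim/squotW: X => x; rewrite !pi_scale scalerA. Qed.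
Let squot_scale1 : left_id 1 squot_scale.
Proof. by elim/squotW => x; rewrite pi_scale scale1r. Qed.
Let squot_scaleDr : right_distributive squot_scale +%R.
Proof.
move=> c; elim/squotW => x; elim/squotW => y.
by rewrite /GRing.add/= !(pi_add, pi_scale) scalerDr.
Qed.
Let squot_scaleDl X : {morph squot_scale^~ X : a b / a + b}.
Proof.
move=> a b; elim/squotW: X => x.
by rewrite [RHS]/GRing.add/= !(pi_add, pi_scale) scalerDl.
Qed.

HB.instance Definition _ := GRing.Zmodule_isLmodule.Build C star_quot
  squot_scaleA squot_scale1 squot_scaleDr squot_scaleDl.

Let squot_scalerAl (c : C) (X Y : star_quot) : c *: (X * Y) = (c *: X) * Y.
Proof.
elim/squotW: X => x; elim/squotW: Y => y.
by rewrite /GRing.scale /GRing.mul/= !(pi_mul, pi_scale) scalerAl.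
Qed.
Let squot_scalerAr (c : C) (X Y : star_quot) : c *: (X * Y) = X * (c *: Y).
Proof.
elim/squotW: X => x; elim/squotW: Y => y.
by rewrite /GRing.scale /GRing.mul/= !(pi_mul, pi_scale) scalerAr.
Qed.
HB.instance Definition _ :=
  GRing.Lmodule_isLalgebra.Build C star_quot squot_scalerAl.
HB.instance Definition _ :=
  GRing.Lalgebra_isAlgebra.Build C star_quot squot_scalerAr.

Let squot_starK : involutive squot_star.
Proof. by elim/squotW => x; rewrite !pi_star starK. Qed.
Let squot_starD : {morph squot_star : x y / x + y}.
Proof.
elim/squotW => x; elim/squotW => y.
by rewrite /GRing.add/= !(pi_add, pi_star) starD.
Qed.
Let squot_starM (X Y : star_quot) :
  squot_star (X * Y) = squot_star Y * squot_star X.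
Proof.
elim/squotW: X => x; elim/squotW: Y => y.
by rewrite /GRing.mul/= !(pi_mul, pi_star) starM.
Qed.
Let squot_starZ (c : C) (X : star_quot) :
  squot_star (c *: X) = (c^*)%R *: squot_star X.
Proof.
elim/squotW: X => x.
by rewrite /GRing.scale/= !(pi_scale, pi_star) starZ.
Qed.

HB.instance Definition _ := hasStar.Build C star_quot
  squot_starK squot_starD squot_starM squot_starZ.

End StarQuotient.

HB.mixin Record isHilbert (R : realType) H
    of CompleteNormedModule R[i] H := {
  dot : H -> H -> R[i] ;
  dot_linear : forall (c : R[i]) (x y z : H),
    dot (c *: x + y) z = c * dot x z + dot y z ;
  dot_conj : forall x y : H, dot y x = ((dot x y)^*)%R ;
  dot_norm : forall x : H, `|x| ^+ 2 = dot x x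
}.

#[short(type="hilbertType")]
HB.structure Definition Hilbert (R : realType) :=
  {H of CompleteNormedModule R[i] H & isHilbert R H}.

Section Dot.
Variables (R : realType) (H : hilbertType R).
Implicit Types x y z : H.

Lemma dotDl x y z : dot (x + y) z = dot x z + dot y z.
Proof. by rewrite -[x]scale1r dot_linear mul1r scale1r. Qed.

Lemma dot0l z : dot (0 : H) z = 0.
Proof. by apply: (addrI (dot 0 z)); rewrite -dotDl !addr0. Qed.

Lemma dotZl (c : R[i]) x z : dot (c *: x) z = c * dot x z.
Proof. by rewrite -[c *: x]addr0 dot_linear dot0l addr0. Qed.

Lemma dotBl x y z : dot (x - y) z = dot x z - dot y z.
Proof. by rewrite dotDl -scaleN1r dotZl mulN1r. Qed.

Lemma dotDr x y z : dot z (x + y) = dot z x + dot z y.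
Proof. by rewrite dot_conj dotDl rmorphD (dot_conj x) (dot_conj y). Qed.

Lemma dotZr (c : R[i]) x z : dot z (c *: x) = (c^*)%R * dot z x.
Proof. by rewrite dot_conj dotZl rmorphM (dot_conj x). Qed.

Lemma dotBr x y z : dot z (x - y) = dot z x - dot z y.
Proof. by rewrite dot_conj dotBl rmorphB (dot_conj x) (dot_conj y). Qed.

Lemma dot_ge0 x : 0 <= dot x x.
Proof. by rewrite -dot_norm exprn_ge0. Qed.

Lemma dot_eq0 x : dot x x = 0 -> x = 0.
Proof. by rewrite -dot_norm => /eqP; rewrite sqrf_eq0 normr_eq0 => /eqP. Qed.

Lemma dot_ext x y : (forall z, dot x z = dot y z) -> x = y.
Proof.
by move=> xy; apply/subr0_eq/dot_eq0; rewrite dotBl xy subrr.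
Qed.

Lemma dot_extr x y : (forall z, dot z x = dot z y) -> x = y.
Proof.
by move=> xy; apply: dot_ext => z; rewrite dot_conj xy -dot_conj.
Qed.

End Dot.

Section BoundedOperators.
Variables (R : realType) (H : hilbertType R).

Definition is_bounded_op (f : H -> H) : Prop :=
  linear f /\ exists K : R[i], forall x, `|f x| <= K * `|x|.

Definition bounded_op_pred : {pred H -> H} := fun f => `[< is_bounded_op f >].

Record bounded_op := BoundedOp {
  bop_fun :> H -> H ;
  bop_funP : bop_fun \in bounded_op_pred
}.
HB.instance Definition _ := [isSub for bop_fun].
HB.instance Definition _ := [Choice of bounded_op by <:].

Let bounded_op_submod : submod_closed bounded_op_pred.
Proof.
split=> [|c f g /asboolP[lf [K fK]] /asboolP[lg [L gL]]]; apply/asboolP.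
  split=> [c x y|]; first by rewrite scaler0 addr0.
  by exists 0 => x; rewrite normr0 mul0r.
split=> [d x y|].
  have fgE z : (c *: f + g) z = c *: f z + g z by [].
  by rewrite !fgE lf lg !scalerDr !scalerA mulrC addrACA.
exists (`|c| * K + L) => x.
rewrite (le_trans (ler_normD _ _))// mulrDl lerD// normrZ -mulrA.
by rewrite ler_wpM2l.
Qed.
HB.instance Definition _ :=
  GRing.isSubmodClosed.Build R[i] (H -> H) bounded_op_pred bounded_op_submod.
HB.instance Definition _ :=
  [SubChoice_isSubLmodule of bounded_op by <:].

Lemma bop_bounded_op (f : bounded_op) : is_bounded_op f.
Proof. exact/asboolP/bop_funP. Qed.

Lemma bop_linear (f : bounded_op) : linear f.
Proof. by case: (bop_bounded_op f). Qed.

Lemma bop_ext (f g : bounded_op) : (forall x, f x = g x) -> f = g.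
Proof. by move=> fg; apply/val_inj/funext. Qed.

Let id_bounded_op : idfun \in bounded_op_pred.
Proof.
by apply/asboolP; split=> [//|]; exists 1 => x; rewrite mul1r.
Qed.

Let comp_bounded_op (f g : bounded_op) : f \o g \in bounded_op_pred.
Proof.
apply/asboolP; have [lf [K fK]] := bop_bounded_op f.
have [lg [L gL]] := bop_bounded_op g.
split=> [c x y|]; first by rewrite /= lg lf.
exists (`|K| * L) => x; rewrite (le_trans (fK _))// -mulrA.
have -> : K * `|g x| = `|K| * `|g x|.
  by rewrite -[LHS]ger0_norm ?normrM ?normr_id// (le_trans _ (fK _)).
by rewrite ler_wpM2l.
Qed.

Definition bop_one : bounded_op := BoundedOp id_bounded_op.
Definition bop_mul (f g : bounded_op) : bounded_op :=
  BoundedOp (comp_bounded_op f g).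

Let bop_mulA : associative bop_mul.
Proof. by move=> f g h; exact: bop_ext. Qed.
Let bop_mul1 : left_id bop_one bop_mul.
Proof. by move=> f; exact: bop_ext. Qed.
Let bop_mulr1 : right_id bop_one bop_mul.
Proof. by move=> f; exact: bop_ext. Qed.
Let bop_mulDl : left_distributive bop_mul +%R.
Proof. by move=> f g h; exact: bop_ext. Qed.
Let bop_mulDr : right_distributive bop_mul +%R.
Proof.
move=> f g h; apply: bop_ext => x /=.
by have := bop_linear f 1 (g x) (h x); rewrite !scale1r.
Qed.

HB.instance Definition _ := GRing.Zmodule_isPzRing.Build bounded_op
  bop_mulA bop_mul1 bop_mulr1 bop_mulDl bop_mulDr.

Lemma bopM (f g : bounded_op) x : (f * g) x = f (g x).
Proof. by []. Qed.

Lemma bopZ (c : R[i]) (f : bounded_op) x : (c *: f) x = c *: f x.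
Proof. by []. Qed.

Lemma bopD (f g : bounded_op) x : (f + g) x = f x + g x.
Proof. by []. Qed.

Lemma bop_scaleAl (c : R[i]) (f g : bounded_op) : c *: (f * g) = (c *: f) * g.
Proof. exact: bop_ext. Qed.

Lemma bop_scaleAr (c : R[i]) (f g : bounded_op) : c *: (f * g) = f * (c *: g).
Proof.
apply: bop_ext => x; have := bop_linear f (-1) 0 0.
rewrite scaler0 addr0 scaleN1r addNr => f0.
by have := bop_linear f c (g x) 0; rewrite f0 !addr0.
Qed.

Definition is_adjoint (a b : bounded_op) : Prop :=
  forall x y, dot (a x) y = dot x (b y).

Definition commutant (B : set bounded_op) : set bounded_op :=
  [set a | forall b, B b -> a * b = b * a].

(* A von Neumann algebra on a nonzero Hilbert space [H]: a self-adjoint set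
   of bounded operators equal to its bicommutant. *)
Record vnAlgebra := VNAlgebra {
  vn_set : set bounded_op ;
  vn_neq0 : exists x : H, x <> 0 ;
  vn_adjoint : forall a, vn_set a -> exists2 b, vn_set b & is_adjoint a b ;
  vn_bicommutant : commutant (commutant vn_set) = vn_set
}.

End BoundedOperators.

Section VNAlgebra.
Variables (R : realType) (H : hilbertType R) (M : vnAlgebra H).

Definition vn_pred : {pred bounded_op H} := fun a => `[< vn_set M a >].

Record vn_elt := VNElt {
  vn_val :> bounded_op H ;
  vn_valP : vn_val \in vn_pred
}.
HB.instance Definition _ := [isSub for vn_val].
HB.instance Definition _ := [Choice of vn_elt by <:].

Lemma vn_set_val (a : vn_elt) : vn_set M a.
Proof. exact/asboolP/vn_valP. Qed.

Let vn_commutant a :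
  (a \in vn_pred) <-> commutant (commutant (vn_set M)) a.
Proof. by rewrite vn_bicommutant; split=> /asboolP. Qed.

Let vn_submod : submod_closed vn_pred.
Proof.
split=> [|c a b /vn_commutant aM /vn_commutant bM]; apply/vn_commutant => d dM.
  by rewrite mul0r mulr0.
by rewrite mulrDl mulrDr -bop_scaleAl -bop_scaleAr aM// bM.
Qed.

Let vn_subring : subring_closed vn_pred.
Proof.
have [_ vnL] := vn_submod.
split=> [|a b aM bM|a b /vn_commutant aM /vn_commutant bM].
- by apply/vn_commutant => d dM; rewrite mul1r mulr1.
- by rewrite addrC -scaleN1r vnL.
- by apply/vn_commutant => d dM; rewrite -mulrA bM// mulrA aM// mulrA.
Qed.

HB.instance Definition _ :=
  GRing.SubChoice_isSubLmodule.Build R[i] (bounded_op H) vn_pred vn_elt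
    vn_submod.
HB.instance Definition _ :=
  GRing.SubZmodule_isSubPzRing.Build (bounded_op H) vn_pred vn_elt vn_subring.

Let vn_oner_neq0 : (1 : vn_elt) != 0.
Proof.
apply/eqP => vn10; have [x x0] := vn_neq0 M; apply: x0.
exact: (congr1 (fun a : vn_elt => a x) vn10).
Qed.
HB.instance Definition _ :=
  GRing.PzSemiRing_isNonZero.Build vn_elt vn_oner_neq0.

Let vn_scalerAl (c : R[i]) (a b : vn_elt) : c *: (a * b) = (c *: a) * b.
Proof. by apply: val_inj; exact: bop_scaleAl. Qed.
HB.instance Definition _ :=
  GRing.Lmodule_isLalgebra.Build R[i] vn_elt vn_scalerAl.

Let vn_scalerAr (c : R[i]) (a b : vn_elt) : c *: (a * b) = a * (c *: b).
Proof. by apply: val_inj; exact: bop_scaleAr. Qed.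
HB.instance Definition _ :=
  GRing.Lalgebra_isAlgebra.Build R[i] vn_elt vn_scalerAr.

Let vn_has_star (a : vn_elt) : exists b : vn_elt, is_adjoint a b.
Proof.
have [b Mb ab] := vn_adjoint (vn_set_val a).
by exists (VNElt (asboolT Mb)).
Qed.

Definition vn_star (a : vn_elt) : vn_elt := projT1 (cid (vn_has_star a)).

Lemma vn_star_adjoint (a : vn_elt) : is_adjoint a (vn_star a).
Proof. exact: projT2 (cid (vn_has_star a)). Qed.

Let vn_starP (a b : vn_elt) : is_adjoint a b -> vn_star a = b.
Proof.
move=> ab; apply/val_inj/bop_ext => y; apply: dot_extr => x.
by rewrite -ab; exact/esym/vn_star_adjoint.
Qed.

Let vn_starK : involutive vn_star.
Proof.
move=> a; apply: vn_starP => x y.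
by rewrite dot_conj -(vn_star_adjoint a) -dot_conj.
Qed.
Let vn_starD : {morph vn_star : a b / a + b}.
Proof.
move=> a b; apply: vn_starP => x y.
by rewrite !bopD dotDl dotDr !vn_star_adjoint.
Qed.
Let vn_starM (a b : vn_elt) : vn_star (a * b) = vn_star b * vn_star a.
Proof. by apply: vn_starP => x y; rewrite !bopM !vn_star_adjoint. Qed.
Let vn_starZ (c : R[i]) (a : vn_elt) :
  vn_star (c *: a) = (c^*)%R *: vn_star a.
Proof.
apply: vn_starP => x y.
by rewrite !bopZ dotZl dotZr conjCK vn_star_adjoint.
Qed.

HB.instance Definition _ := hasStar.Build R[i] vn_elt
  vn_starK vn_starD vn_starM vn_starZ.

Lemma dot_star (a : vn_elt) x y : dot (a x) y = dot x (star a y).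
Proof. exact: vn_star_adjoint. Qed.

Lemma dot_starl (a : vn_elt) x y : dot (star a x) y = dot x (a y).
Proof. by rewrite dot_star starK. Qed.

Definition op_ge0 (a : vn_elt) : Prop := forall x, 0 <= dot (a x) x.

Definition op_le (a b : vn_elt) : Prop := op_ge0 (b - a).

Definition directed (D : set vn_elt) : Prop :=
  D !=set0 /\
  forall a b, D a -> D b -> exists2 c, D c & op_le a c /\ op_le b c.

Definition op_is_lub (D : set vn_elt) (s : vn_elt) : Prop :=
  (forall a, D a -> op_le a s) /\
  (forall t, (forall a, D a -> op_le a t) -> op_le s t).

Definition is_factor : Prop :=
  forall z : vn_elt, (forall a, z * a = a * z) -> exists c : R[i], z = c%:A.

Definition finite_dimensional : Prop :=
  exists n (b : 'I_n -> vn_elt),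
    forall a, exists c : 'I_n -> R[i], a = \sum_i c i *: b i.

Record tracial_state := TracialState {
  tr :> vn_elt -> R[i] ;
  tr_linear : forall (c : R[i]) a b, tr (c *: a + b) = c * tr a + tr b ;
  tr_ge0 : forall a, op_ge0 a -> 0 <= tr a ;
  tr1 : tr 1 = 1 ;
  trC : forall a b, tr (a * b) = tr (b * a)
}.

Definition faithful (tau : tracial_state) : Prop :=
  forall a, op_ge0 a -> tau a = 0 -> a = 0.

Definition normal (tau : tracial_state) : Prop :=
  forall (D : set vn_elt) s, (forall a, D a -> op_ge0 a) ->
    directed D -> op_is_lub D s ->
    complex.Re (tau s) = sup [set complex.Re (tau a) | a in D].

(* [tau] is determined by [M]: a II_1 factor has a unique tracial state, and
   that state is faithful and normal. *)
Definition is_II1_factor (tau : tracial_state) : Prop :=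
  [/\ is_factor, ~ finite_dimensional, faithful tau & normal tau].

Definition norm2 (tau : tracial_state) (a : vn_elt) : R :=
  Num.sqrt (complex.Re (tau (star a * a))).

End VNAlgebra.

Section BoundedSequences.
Variables (R : realType) (H : hilbertType R) (M : vnAlgebra H).

Definition norm_bounded (x : nat -> vn_elt M) : Prop :=
  exists K : R[i], forall n (xi : H), `|x n xi| <= K * `|xi|.

Definition linf_pred : {pred nat -> vn_elt M} := fun x => `[< norm_bounded x >].

Record linf := Linf {
  linf_seq :> nat -> vn_elt M ;
  linf_seqP : linf_seq \in linf_pred
}.
HB.instance Definition _ := [isSub for linf_seq].
HB.instance Definition _ := [Choice of linf by <:].

Let linf_predP (x : nat -> vn_elt M) : x \in linf_pred <->
  exists2 K : R[i], 0 < K & forall n xi, `|x n xi| <= K * `|xi|.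
Proof.
split=> [/asboolP[K xK]|[K _ xK]]; last by apply/asboolP; exists K.
exists (`|K| + 1) => [|n xi]; first by rewrite ltr_wpDl.
have KE : K * `|xi| = `|K| * `|xi|.
  by rewrite -[LHS]ger0_norm ?normrM ?normr_id// (le_trans _ (xK n xi)).
by rewrite (le_trans (xK n xi))// KE ler_wpM2r// lerDl.
Qed.

Lemma linf_bounded (x : linf) :
  exists2 K : R[i], 0 < K & forall n xi, `|x n xi| <= K * `|xi|.
Proof. exact/linf_predP/linf_seqP. Qed.

Let linf_submod : submod_closed linf_pred.
Proof.
split=> [|c x y /linf_predP[K K0 xK] /linf_predP[L L0 yL]]; apply/asboolP.
  by exists 0 => n xi; rewrite mul0r normr0.
exists (`|c| * K + L) => n xi.
rewrite (le_trans (ler_normD (c *: x n xi) (y n xi)))// mulrDl lerD// normrZ -mulrA.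
by rewrite ler_wpM2l.
Qed.

Let linf_subring : subring_closed linf_pred.
Proof.
have [_ linfL] := linf_submod.
split=> [|x y xb yb|x y /linf_predP[K K0 xK] /linf_predP[L L0 yL]].
- by apply/asboolP; exists 1 => n xi; rewrite mul1r lexx.
- by rewrite addrC -scaleN1r linfL.
- apply/asboolP; exists (K * L) => n xi.
  by rewrite (le_trans (xK n (y n xi)))// -mulrA ler_wpM2l// ltW.
Qed.

HB.instance Definition _ :=
  GRing.SubChoice_isSubLmodule.Build R[i] (nat -> vn_elt M) linf_pred linf
    linf_submod.
HB.instance Definition _ :=
  GRing.SubZmodule_isSubPzRing.Build (nat -> vn_elt M) linf_pred linf
    linf_subring.

Let linf_oner_neq0 : (1 : linf) != 0.
Proof.
apply/eqP => /(congr1 (fun x : linf => x 0%N))/eqP.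
by apply/negP; exact: oner_neq0.
Qed.
HB.instance Definition _ :=
  GRing.PzSemiRing_isNonZero.Build linf linf_oner_neq0.

Let linf_ext (x y : linf) : (forall n, x n = y n) -> x = y.
Proof. by move=> xy; apply/val_inj/funext. Qed.

Let linf_scalerAl (c : R[i]) (x y : linf) : c *: (x * y) = (c *: x) * y.
Proof. by apply: linf_ext => n; exact: scalerAl. Qed.
HB.instance Definition _ :=
  GRing.Lmodule_isLalgebra.Build R[i] linf linf_scalerAl.

Let linf_scalerAr (c : R[i]) (x y : linf) : c *: (x * y) = x * (c *: y).
Proof. by apply: linf_ext => n; exact: scalerAr. Qed.
HB.instance Definition _ :=
  GRing.Lalgebra_isAlgebra.Build R[i] linf linf_scalerAr.

Let star_bound (a : vn_elt M) (K : R[i]) : 0 < K ->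
  (forall xi, `|a xi| <= K * `|xi|) -> forall xi, `|star a xi| <= K * `|xi|.
Proof.
move=> K0 aK xi; set eta := star a xi.
have KR : (K^*)%R = K by apply/CrealP; rewrite ger0_real// ltW.
have K2 : 0 < K ^+ 2 by rewrite exprn_gt0.
have aE : dot (a eta) xi = `|eta| ^+ 2.
  by rewrite dot_star dot_norm.
have aE' : dot xi (a eta) = `|eta| ^+ 2.
  rewrite dot_conj aE; apply/CrealP.
  by rewrite rpredX// normr_real.
have := dot_ge0 (a eta - K ^+ 2 *: xi).
rewrite dotBl !dotBr !dotZl !dotZr rmorphXn/= KR aE aE' -!dot_norm => ineq.
have aeta : `|a eta| ^+ 2 <= K ^+ 2 * `|eta| ^+ 2.
  by rewrite -exprMn lerXn2r ?nnegrE// mulr_ge0// ltW.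
move: ineq; rewrite subr_ge0 => ineq.
have := le_trans ineq; rewrite -subr_le0 in aeta => /(_ _ aeta).
rewrite subr_le0 (ler_pM2l K2) -exprMn.
by rewrite ler_pXn2r// nnegrE// mulr_ge0// ltW.
Qed.

Let linf_starP (x : linf) : (fun n => star (x n)) \in linf_pred.
Proof.
have [K K0 xK] := linf_bounded x; apply/asboolP; exists K => n.
exact: star_bound.
Qed.

Definition linf_star (x : linf) : linf := Linf (linf_starP x).

Let linf_starK : involutive linf_star.
Proof. by move=> x; apply: linf_ext => n; exact: starK. Qed.
Let linf_starD : {morph linf_star : x y / x + y}.
Proof. by move=> x y; apply: linf_ext => n; exact: starD. Qed.
Let linf_starM (x y : linf) : linf_star (x * y) = linf_star y * linf_star x.
Proof. by apply: linf_ext => n; exact: starM. Qed.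
Let linf_starZ (c : R[i]) (x : linf) :
  linf_star (c *: x) = (c^*)%R *: linf_star x.
Proof. by apply: linf_ext => n; exact: starZ. Qed.

HB.instance Definition _ := hasStar.Build R[i] linf
  linf_starK linf_starD linf_starM linf_starZ.

End BoundedSequences.

Section Ultrapower.
Variables (R : realType) (H : hilbertType R) (M : vnAlgebra H).
Variables (tau : tracial_state M).
Implicit Types a b : vn_elt M.

Let trD a b : tau (a + b) = tau a + tau b.
Proof. by have := tr_linear tau 1 a b; rewrite scale1r mul1r. Qed.

Let tr0 : tau 0 = 0.
Proof. by apply: (addrI (tau 0)); rewrite -trD !addr0. Qed.

Let trZ (c : R[i]) a : tau (c *: a) = c * tau a.
Proof. by have := tr_linear tau c a 0; rewrite tr0 !addr0. Qed.

Let trB a b : tau (a - b) = tau a - tau b.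
Proof. by rewrite trD -scaleN1r trZ mulN1r. Qed.

Let starl_ge0 a : op_ge0 (star a * a).
Proof.
move=> x; rewrite (_ : (star a * a) x = star a (a x))//.
by rewrite dot_starl dot_ge0.
Qed.

Let q a : R := complex.Re (tau (star a * a)).

Let Re_le (z w : R[i]) : z <= w -> complex.Re z <= complex.Re w.
Proof. by rewrite lecE => /andP[]. Qed.

Let q_ge0 a : 0 <= q a.
Proof. exact: (Re_le (tr_ge0 tau (starl_ge0 a))). Qed.

Let qD a b : q (a + b) <= 2 * (q a + q b).
Proof.
have abE : star (a + b) * (a + b) + star (a - b) * (a - b) =
    (star a * a + star a * a) + (star b * b + star b * b).
  have -> : star (a + b) * (a + b) =
      (star a * a + star b * b) + (star a * b + star b * a).
    by rewrite starD mulrDl !mulrDr [star b * a + _]addrC addrACA.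
  have -> : star (a - b) * (a - b) =
      (star a * a + star b * b) - (star a * b + star b * a).
    by rewrite starB mulrBl !mulrBr opprB addrACA opprD.
  by rewrite addrACA subrr addr0 addrACA.
have qE c d : complex.Re (tau (star c * c)) + complex.Re (tau (star d * d)) =
    complex.Re (tau (star c * c + star d * d)) by rewrite trD raddfD.
have <- : q (a + b) + q (a - b) = 2 * (q a + q b).
  by rewrite /q qE abE !trD !raddfD/= -!mulr2n -mulrnDl mulr_natl.
by rewrite lerDl.
Qed.

Let q_star a : q (star a) = q a.
Proof. by rewrite /q starK trC. Qed.

Let qM a b (K : R[i]) : 0 < K -> (forall xi, `|a xi| <= K * `|xi|) ->
  q (a * b) <= complex.Re K ^+ 2 * q b.
Proof.
case: K => k l; rewrite ltcE/= => /andP[/eqP-> k0] aK.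
have : op_ge0 ((k ^+ 2)%:C *: (star b * b) - star (a * b) * (a * b)).
  move=> x.
  rewrite (_ : vn_val _ x =
    (k ^+ 2)%:C *: star b (b x) - star (a * b) ((a * b) x))//.
  rewrite dotBl dotZl !dot_starl -!dot_norm subr_ge0 rmorphXn/= -exprMn.
  by rewrite lerXn2r ?nnegrE// ?aK// (le_trans _ (aK (b x))).
move=> /(tr_ge0 tau); rewrite trB trZ subr_ge0 => /Re_le; rewrite /q.
by case: (tau (star b * b)) => u v /=; rewrite mul0r subr0.
Qed.

Lemma norm2_cvg0 (omega : set_system nat) {Fomega : ProperFilter omega}
    (x : nat -> vn_elt M) :
  (norm2 tau (x n) @[n --> omega] --> 0) <->
  (complex.Re (tau (star (x n) * x n)) @[n --> omega] --> 0).
Proof.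
split=> [x0|x0].
  have -> : (fun n => complex.Re (tau (star (x n) * x n))) =
            (fun n => norm2 tau (x n) * norm2 tau (x n)).
    by apply/funext => n; rewrite -expr2 sqr_sqrtr//; exact: q_ge0.
  by rewrite -[X in _ --> X](mulr0 (0 : R)); exact: cvgM.
rewrite -[X in _ --> X](@sqrtr0 R).
by apply: continuous_cvg; first exact: sqrt_continuous.
Qed.

Variables (omega : set_system nat) (Uomega : UltraFilter omega).

Definition null_seq (x : linf M) : Prop :=
  norm2 tau (x n) @[n --> omega] --> 0.

Let null_seqP x : null_seq x <-> q (x n) @[n --> omega] --> 0.
Proof. exact: norm2_cvg0. Qed.

Let null_seq_le (k : R) (x y : linf M) : (forall n, q (y n) <= k * q (x n)) ->
  null_seq x -> null_seq y.
Proof.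
move=> yx /null_seqP x0; apply/null_seqP.
apply: (squeeze_cvgr (f := cst 0) (h := fun n => k * q (x n))).
- by apply: nearW => n; rewrite /= q_ge0 yx.
- exact: cvg_cst.
- by rewrite -[X in _ --> X](mulr0 k); apply: cvgM => //; exact: cvg_cst.
Qed.

Let null_seq0 : null_seq 0.
Proof.
rewrite /null_seq (_ : (fun n => _) = cst 0); first exact: cvg_cst.
by apply/funext => n; rewrite /norm2 mulr0 tr0 sqrtr0.
Qed.

Let null_seq1 : ~ null_seq 1.
Proof.
rewrite /null_seq (_ : (fun n => _) = cst 1).
  by move=> /(cvg_unique (@norm_hausdorff R R) (cvg_cst (1 : R)))/eqP; rewrite oner_eq0.
by apply/funext => n; rewrite /norm2 star1 mulr1 tr1 sqrtr1.
Qed.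

Let null_seqD x y : null_seq x -> null_seq y -> null_seq (x + y).
Proof.
move=> /null_seqP x0 /null_seqP y0; apply/null_seqP.
apply: (squeeze_cvgr (f := cst 0) (h := fun n => 2 * (q (x n) + q (y n)))).
- by apply: nearW => n; rewrite /= q_ge0; exact: qD.
- exact: cvg_cst.
- rewrite -[X in _ --> X](mulr0 (2 : R)); apply: cvgM; first exact: cvg_cst.
  by rewrite -[X in _ --> X](addr0 (0 : R)); exact: cvgD.
Qed.

Let null_seq_star x : null_seq x -> null_seq (star x).
Proof.
by apply: (@null_seq_le 1) => n; rewrite mul1r -(q_star (x n)) lexx.
Qed.

Let null_seqMl (a x : linf M) : null_seq x -> null_seq (a * x).
Proof.
have [K K0 aK] := linf_bounded a.
apply: (@null_seq_le (complex.Re K ^+ 2)) => n.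
by apply: qM => // xi; exact: aK.
Qed.

Let null_seqMr (a x : linf M) : null_seq x -> null_seq (x * a).
Proof.
move=> /null_seq_star/(null_seqMl (star a))/null_seq_star.
by rewrite -starM starK.
Qed.

Definition null_ideal : starIdeal (linf M) :=
  StarIdeal null_seq0 null_seq1 null_seqD null_seqMl null_seqMr null_seq_star.

Definition ultrapower := star_quot null_ideal.
HB.instance Definition _ := StarAlgebra.on ultrapower.

(* [theta^omega], sending the class of (x_n) to the class of (theta (x_n)).
   For a star-automorphism [theta] of a II_1 factor the sequence
   (theta (x_n)) is again norm-bounded, since [theta] is isometric, so that
   the default value 0 of [insubd] is never used; and its class does not depend
   on the representative, since the trace is unique and thus [theta]-invariant.
   *)
Definition ultrapower_map (theta : vn_elt M -> vn_elt M) (X : ultrapower) :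
    ultrapower :=
  \pi_ultrapower (insubd (0 : linf M) (fun n => theta (repr X n))).

End Ultrapower.

(* Main.v *)
Require Import Defs.
From HB Require Import structures.
From mathcomp Require Import all_boot all_order all_algebra.
From mathcomp Require Import complex.
From mathcomp Require Import all_classical all_reals all_analysis.
From mathcomp Require Import ring lra.

Set Implicit Arguments.
Unset Strict Implicit.
Unset Printing Implicit Defensive.

Import Order.TTheory GRing.Theory Num.Theory numFieldNormedType.Exports.

Local Open Scope classical_set_scope.
Local Open Scope ring_scope.
Local Open Scope quotient_scope.

(** Write [q a = tau (star a * a)] for the squared 2-norm.

    Suppose that [theta^omega] is conjugation by the class of a bounded
    sequence [u_n].  Applying this to a sequence of unitaries [v_n] that are
    the worst possible at each index [n] turns the limit into a uniform
    estimate: some single [u = u_n] satisfies [q u > 1/2] and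
    [q (theta v * u - u * v) <= 1/4] for all unitaries [v] at once
    ([approximate_intertwiner]).  Such a [u] is corrected to an exact
    intertwiner.  The set of all [c], bounded like [u], with
    [q (c - theta v * u * star v) <= 1/4] for every unitary [v] is convex,
    contains [u], and is invariant under the action
    [c |-> theta w * c * star w] of the unitary group, which is isometric for
    the 2-norm.  A minimizing sequence for [q] on this set is Cauchy by the
    parallelogram law, and its limit [y] is a fixed point:
    [theta a * y = y * a] for unitary [a], hence for every [a]
    ([invariant_set_intertwiner]); and [y] is not [0] because [u] is too large
    ([exact_intertwiner]).  Then [star y * y] and [y * star y] are central,
    that is scalar, so a multiple of [y] is a unitary implementing [theta]
    ([inner_of_intertwiner]).

    Two analytic facts carry this.  The first is that bounded 2-norm Cauchy
    sequences converge in the algebra ([bounded_sq2_complete]).  If the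
    increments [d_n] decrease fast enough, the sums [s_N] of
    [4 ^ n star d_n * d_n] have bounded trace, so that the decreasing limit
    [r] of the resolvents [(1 + e s_N)^-1] has [tau (1 - r)] of order [e], by
    normality; on the range of [r] the operator [d_n] has norm of order
    [2 ^ - n], so the sequence converges strongly there; and [r] increases to
    [1] as [e] tends to [0], by faithfulness ([approximate_unit]).  The limit
    commutes with the commutant, so it lies in the algebra.

    The second is that [theta] preserves the trace ([trace_aut_invariant]);
    this is what makes the class of [theta (x_n)] independent of the
    representative [x_n] of a class.  It amounts to the uniqueness of the
    trace, obtained from the same fixed point argument for conjugation by
    unitaries and the faithful normal trace [tau + tau o theta]: the fixed
    point is a scalar on which both traces take their value at a given element.

    The only function of an operator that is used is the resolvent
    [(1 + s)^-1] of a positive [s]; it stands in for the functional calculus. *)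

(** * The real inner product of a Hilbert space *)

Section RealInnerProduct.
Variables (R : realType) (H : hilbertType R).
Implicit Types x y z : H.

Definition rdot x y : R := complex.Re (dot x y).

(** Squared norms are used throughout: they take values in [R] and need no
    square roots. *)
Definition sqn x : R := rdot x x.

Lemma rdotDl x y z : rdot (x + y) z = rdot x z + rdot y z.
Proof. by rewrite /rdot dotDl raddfD. Qed.

Lemma rdotBl x y z : rdot (x - y) z = rdot x z - rdot y z.
Proof. by rewrite /rdot dotBl raddfB. Qed.

Lemma rdotC x y : rdot x y = rdot y x.
Proof. by rewrite /rdot dot_conj; case: (dot y x). Qed.

Lemma rdotDr x y z : rdot z (x + y) = rdot z x + rdot z y.
Proof. by rewrite rdotC rdotDl !(rdotC _ z). Qed.

Lemma rdotBr x y z : rdot z (x - y) = rdot z x - rdot z y.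
Proof. by rewrite rdotC rdotBl !(rdotC _ z). Qed.

Lemma rdotZl (c : R) x y : rdot (c%:C%C *: x) y = c * rdot x y.
Proof.
by rewrite /rdot dotZl; case: (dot x y) => u v /=; rewrite mul0r subr0.
Qed.

Lemma rdotZr (c : R) x y : rdot x (c%:C%C *: y) = c * rdot x y.
Proof. by rewrite rdotC rdotZl rdotC. Qed.

Lemma rdot0l x : rdot 0 x = 0.
Proof. by rewrite /rdot dot0l. Qed.

Lemma rdotNl x y : rdot (- x) y = - rdot x y.
Proof. by rewrite -sub0r rdotBl rdot0l sub0r. Qed.

Lemma dot_sqn x : dot x x = (sqn x)%:C%C.
Proof.
have := dot_ge0 x; rewrite /sqn /rdot; case: (dot x x) => u v.
by rewrite lecE/= => /andP[/eqP -> _].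
Qed.

Lemma norm_sqn x : `|x| ^+ 2 = (sqn x)%:C%C.
Proof. by rewrite dot_norm dot_sqn. Qed.

Lemma sqn_ge0 x : 0 <= sqn x.
Proof. by have := dot_ge0 x; rewrite dot_sqn lecE/= => /andP[]. Qed.

Lemma sqn_eq0 x : sqn x = 0 -> x = 0.
Proof. by move=> x0; apply: dot_eq0; rewrite dot_sqn x0. Qed.

Lemma sqn0 : sqn (0 : H) = 0.
Proof. exact: rdot0l. Qed.

Lemma sqnN x : sqn (- x) = sqn x.
Proof. by rewrite /sqn rdotNl rdotC rdotNl opprK. Qed.

Lemma sqnBC x y : sqn (x - y) = sqn (y - x).
Proof. by rewrite -sqnN opprB. Qed.

Lemma sqnZ (c : R) x : sqn (c%:C%C *: x) = c ^+ 2 * sqn x.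
Proof. by rewrite /sqn rdotZl rdotZr mulrA. Qed.

Lemma sqnD x y : sqn (x + y) = sqn x + 2 * rdot x y + sqn y.
Proof. rewrite /sqn rdotDl !rdotDr (rdotC y x); ring. Qed.

Lemma sqnB x y : sqn (x - y) = sqn x - 2 * rdot x y + sqn y.
Proof. rewrite /sqn rdotBl !rdotBr (rdotC y x); ring. Qed.

Lemma sqnD_le x y : sqn (x + y) <= 2 * sqn x + 2 * sqn y.
Proof. by have := sqn_ge0 (x - y); rewrite sqnB sqnD; lra. Qed.

Lemma sqnB_le x y : sqn (x - y) <= 2 * sqn x + 2 * sqn y.
Proof. by rewrite -(sqnN y) sqnD_le. Qed.

(** The weight [e] lets a geometric rate arbitrarily close to [1] survive the
    use of squared norms; see [geometric_step]. *)
Lemma sqnD_weighted (e : R) x y : 0 < e ->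
  sqn (x + y) <= (1 + e) * sqn x + (1 + e^-1) * sqn y.
Proof.
move=> e0; have := sqn_ge0 (e%:C%C *: x - y).
rewrite sqnB sqnZ rdotZl sqnD => h.
have {}h : 0 <= e * sqn x - 2 * rdot x y + e^-1 * sqn y.
  have := mulr_ge0 (ltW e0) (sqn_ge0 x).
  have -> : e * sqn x - 2 * rdot x y + e^-1 * sqn y =
    e^-1 * (e ^+ 2 * sqn x - 2 * (e * rdot x y) + sqn y).
    by field; rewrite gt_eqF.
  by move=> _; rewrite mulr_ge0// invr_ge0 ltW.
lra.
Qed.

Lemma rdot_CS x y : rdot x y ^+ 2 <= sqn x * sqn y.
Proof.
have [y0|y0] := eqVneq (sqn y) 0.
  by rewrite y0 mulr0 (sqn_eq0 y0) rdotC rdot0l expr0n.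
have {y0} : 0 < sqn y by rewrite lt_def y0 sqn_ge0.
move=> y0; have := sqn_ge0 ((sqn y)%:C%C *: x - (rdot x y)%:C%C *: y).
rewrite sqnB !sqnZ rdotZl rdotZr => h.
by rewrite -(ler_pM2l y0); nra.
Qed.

Lemma sqn_ext x y : (forall z, rdot x z = rdot y z) -> x = y.
Proof. by move=> xy; apply/subr0_eq/sqn_eq0; rewrite /sqn rdotBl xy subrr. Qed.

Lemma sqnZC (k : R[i]) x : sqn (k *: x) = complex.Re (k * (k^*)%R) * sqn x.
Proof. by rewrite /sqn /rdot dotZl dotZr dot_sqn; case: k => u v /=; ring. Qed.

Definition hlim (x : nat -> H) (l : H) : Prop :=
  sqn (x n - l) @[n --> \oo] --> (0 : R).

Lemma cvg0_le (u v : R^nat) : (forall n, 0 <= u n <= v n) ->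
  v n @[n --> \oo] --> (0 : R) -> u n @[n --> \oo] --> (0 : R).
Proof.
move=> uv v0; apply: (squeeze_cvgr (f := cst 0) (h := v)) => //.
  exact: nearW.
exact: cvg_cst.
Qed.

Lemma cvg0M (c : R) (u : R^nat) : u n @[n --> \oo] --> (0 : R) ->
  c * u n @[n --> \oo] --> (0 : R).
Proof.
move=> u0; rewrite -[X in _ --> X](mulr0 c); apply: cvgM => //.
exact: cvg_cst.
Qed.

Lemma cvg0D (u v : R^nat) : u n @[n --> \oo] --> (0 : R) ->
  v n @[n --> \oo] --> (0 : R) -> u n + v n @[n --> \oo] --> (0 : R).
Proof.
by move=> u0 v0; rewrite -[X in _ --> X](addr0 (0 : R)); exact: cvgD.
Qed.

Lemma hlim_cst l : hlim (fun=> l) l.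
Proof.
rewrite /hlim (_ : (fun _ => _) = cst 0); first exact: cvg_cst.
by apply/funext => n; rewrite subrr sqn0.
Qed.

Lemma hlimB (x y : nat -> H) l m :
  hlim x l -> hlim y m -> hlim (fun n => x n - y n) (l - m).
Proof.
move=> xl ym.
apply: (@cvg0_le _ (fun n => 2 * sqn (x n - l) + 2 * sqn (y n - m))).
  move=> n; rewrite sqn_ge0/=.
  rewrite (_ : _ - _ - _ = (x n - l) - (y n - m)) ?sqnB_le//.
  by rewrite !opprB [m - l]addrC addrACA [- y n + m]addrC.
by apply: cvg0D; exact: cvg0M.
Qed.

Lemma hlim_comp (f : H -> H) (K : R) (x : nat -> H) l :
  {morph f : u v / u - v} ->
  (forall u, sqn (f u) <= K * sqn u) -> hlim x l -> hlim (f \o x) (f l).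
Proof.
move=> fB fK xl; apply: (@cvg0_le _ (fun n => K * sqn (x n - l))).
  by move=> n; rewrite sqn_ge0/= -fB fK.
exact: cvg0M.
Qed.

Lemma hlimZ (k : R[i]) (x : nat -> H) l :
  hlim x l -> hlim (fun n => k *: x n) (k *: l).
Proof.
apply: (@hlim_comp ( *:%R k)) => u; last by rewrite sqnZC.
by move=> v; rewrite scalerBr.
Qed.

Lemma hlimN (x : nat -> H) l : hlim x l -> hlim (fun n => - x n) (- l).
Proof.
apply: (@hlim_comp -%R 1) => u; last by rewrite sqnN mul1r.
by move=> v; rewrite opprB opprK addrC.
Qed.

Lemma hlimD (x y : nat -> H) l m :
  hlim x l -> hlim y m -> hlim (fun n => x n + y n) (l + m).
Proof.
move=> xl /hlimN ym; have := hlimB xl ym; rewrite opprK.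
by congr hlim; apply/funext => n; rewrite opprK.
Qed.

Lemma hlim_rdot (x : nat -> H) l y :
  hlim x l -> rdot (x n) y @[n --> \oo] --> rdot l y.
Proof.
move=> xl; apply/cvgrPdist_le => e e0.
have e2 : 0 < e ^+ 2 / (sqn y + 1).
  by rewrite divr_gt0 ?exprn_gt0// ltr_wpDl// sqn_ge0.
move/cvgrPdist_le : xl => /(_ _ e2); apply: filterS => n /=.
rewrite sub0r normrN ger0_norm ?sqn_ge0// => h.
have {}h : rdot (l - x n) y ^+ 2 <= e ^+ 2.
  apply: (le_trans (rdot_CS _ _)).
  rewrite sqnBC; apply: (@le_trans _ _ (e ^+ 2 / (sqn y + 1) * sqn y)).
    by rewrite ler_wpM2r// sqn_ge0.
  rewrite -mulrA ler_piMr ?sqr_ge0// mulrC ler_pdivrMr ?mul1r ?lerDl//.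
  by rewrite ltr_wpDl// sqn_ge0.
by rewrite -rdotBl ler_norml; apply/andP; split; nra.
Qed.

Lemma hlim_unique (x : nat -> H) l m : hlim x l -> hlim x m -> l = m.
Proof.
move=> xl xm; apply: sqn_ext => z.
have := cvg_unique (@norm_hausdorff R R) (hlim_rdot (y := z) xl).
by apply; exact: hlim_rdot.
Qed.

(** Since [2 rdot (x n) l <= sqn (x n) + sqn l], weak convergence is enough. *)
Lemma hlim_sqn_le (N : nat) (B : R) (x : nat -> H) l : hlim x l ->
  (forall n, (N <= n)%N -> sqn (x n) <= B) -> sqn l <= B.
Proof.
move=> xl xB.
have /cvgr_to_le h : 2 * rdot (x n) l @[n --> \oo] --> 2 * rdot l l.
  by apply: cvgM; [exact: cvg_cst | exact: hlim_rdot].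
have : 2 * rdot l l <= B + sqn l.
  apply: h; exists N => // n Nn; have := xB n Nn; have := sqn_ge0 (x n - l).
  rewrite sqnB /=; lra.
rewrite -/(sqn l); lra.
Qed.

Lemma hlim_cauchy (x : nat -> H) :
  (forall e : R, 0 < e -> exists N, forall m n, (N <= m)%N -> (N <= n)%N ->
     sqn (x m - x n) <= e) ->
  exists l, hlim x l.
Proof.
move=> xC.
have : cvg (x @ \oo).
  apply/cauchy_cvgP/cauchy_exP => -[e e'].
  rewrite ltcE/= => /andP[/eqP -> {e'} e0].
  have e20 : 0 < (e / 2) ^+ 2 by rewrite exprn_gt0// divr_gt0.
  have [N xN] := xC _ e20.
  exists (x N); exists N => // n /= Nn; rewrite -ball_normE/=.
  have : `|x N - x n| ^+ 2 <= ((e / 2)%:C%C) ^+ 2.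
    by rewrite norm_sqn -rmorphXn/= lecR xN.
  rewrite ler_pXn2r ?nnegrE ?lecR//; last by rewrite divr_ge0// ltW.
  move/le_lt_trans; apply; rewrite ltcR; lra.
move=> /cvg_ex[l xl]; exists l; apply/cvgrPdist_le => e e0.
have : 0 < (Num.min 1 e)%:C%C by rewrite ltcR lt_min ltr01 e0.
move/cvgrPdist_le : xl => xl /xl{xl}; apply: filterS => n /= h.
rewrite sub0r normrN ger0_norm ?sqn_ge0// sqnBC.
have : `|l - x n| ^+ 2 <= (Num.min 1 e)%:C%C ^+ 2.
  by rewrite lerXn2r ?nnegrE// lecR le_min ler01 ltW.
rewrite norm_sqn -rmorphXn/= lecR => /le_trans; apply.
have [e1|e1] := leP 1 e; first by rewrite expr1n.
by rewrite expr2 ler_piMl// ltW.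
Qed.

(** Splitting off the first increment and putting weight [(1 - r) / (2 r)] on
    the rest multiplies the rate [r] by [1 + (1 - r) / (2 r)], which gives
    [(1 + r) / 2 < 1]: the bound reproduces itself in the induction on [k]. *)
Lemma geometric_step (x : nat -> H) (A r : R) : 0 < r < 1 ->
  (forall n, sqn (x n.+1 - x n) <= A * r ^+ n) ->
  forall k n,
    sqn (x (n + k)%N - x n) <= 2 * A * (1 + r) / (1 - r) ^+ 2 * r ^+ n.
Proof.
move=> /andP[r0 r1] xA.
have A0 : 0 <= A by have := le_trans (sqn_ge0 _) (xA 0%N); rewrite expr0 mulr1.
have r1' : 0 < 1 - r by lra.
elim=> [|k IH] n.
  rewrite addn0 subrr sqn0; apply: mulr_ge0; last by rewrite exprn_ge0// ltW.
  by apply: divr_ge0; [apply: mulr_ge0; lra | exact: sqr_ge0].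
have -> : x (n + k.+1)%N - x n = (x (n.+1 + k)%N - x n.+1) + (x n.+1 - x n).
  by rewrite addrA subrK addSnnS.
have e0 : 0 < (1 - r) / (2 * r) by rewrite divr_gt0// mulr_gt0.
apply: (le_trans (sqnD_weighted _ _ e0)).
set B := _ / _ in IH *.
have h1 := IH n.+1; have h2 := xA n.
rewrite exprS in h1.
set X := sqn _ in h1 *; set Y := sqn _ in h2 *.
apply: (@le_trans _ _ ((1 + (1 - r) / (2 * r)) * (B * (r * r ^+ n)) +
   (1 + ((1 - r) / (2 * r))^-1) * (A * r ^+ n))).
  by rewrite lerD// ler_wpM2l// addr_ge0 ?invr_ge0 ?ltW.
rewrite le_eqVlt; apply/orP; left; apply/eqP; rewrite /B.
by field; rewrite (gt_eqF r0)/= gt_eqF.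
Qed.

Lemma cvg0_geometric (C r : R) :
  0 < r < 1 -> C * r ^+ n @[n --> \oo] --> (0 : R).
Proof.
move=> /andP[r0 r1]; apply: cvg0M.
by have := @cvg_expr R r; apply; rewrite ger0_norm// ltW.
Qed.

Lemma hlim_geometric (x : nat -> H) (A r : R) : 0 < r < 1 ->
  (forall n, sqn (x n.+1 - x n) <= A * r ^+ n) -> exists l, hlim x l.
Proof.
move=> r01 xA; apply: hlim_cauchy => e e0.
set B := 2 * A * (1 + r) / (1 - r) ^+ 2.
have e4 : 0 < e / 4 by lra.
have /cvgrPdist_le/(_ _ e4)[N _ NP] := @cvg0_geometric B r r01.
have {}NP : B * r ^+ N <= e / 4.
  have := NP N (leqnn N); rewrite /= sub0r normrN; apply: le_trans.
  exact: ler_norm.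
exists N => m n Nm Nn; rewrite -(subnKC Nm) -(subnKC Nn).
rewrite -(subrK (x N) (x (N + _)%N)) -addrA.
apply: (le_trans (sqnD_le _ _)); rewrite [sqn (x N - _)]sqnBC.
have := geometric_step r01 xA (m - N) N.
have := geometric_step r01 xA (n - N) N; rewrite -/B; lra.
Qed.

End RealInnerProduct.

(** * Von Neumann algebra elements and the operator order *)

Section OperatorOrder.
Variables (R : realType) (H : hilbertType R) (M : vnAlgebra H).
Implicit Types (a b c s : vn_elt M) (x y : H).

Lemma vnM a b x : (a * b) x = a (b x). Proof. by []. Qed.
Lemma vnD a b x : (a + b) x = a x + b x. Proof. by []. Qed.
Lemma vnB a b x : (a - b) x = a x - b x. Proof. by []. Qed.
Lemma vnZ (k : R[i]) a x : (k *: a) x = k *: a x. Proof. by []. Qed.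
Lemma vn1 x : (1 : vn_elt M) x = x. Proof. by []. Qed.
Lemma vn0 x : (0 : vn_elt M) x = 0. Proof. by []. Qed.

Lemma vn_lin a (k : R[i]) x y : a (k *: x + y) = k *: a x + a y.
Proof. exact: bop_linear. Qed.

Lemma vn_addr a x y : a (x + y) = a x + a y.
Proof. by rewrite -[x in LHS]scale1r vn_lin scale1r. Qed.

Lemma vn_zero a : a 0 = 0.
Proof. by apply: (addrI (a 0)); rewrite -vn_addr !addr0. Qed.

Lemma vn_scale a (k : R[i]) x : a (k *: x) = k *: a x.
Proof. by rewrite -[k *: x in LHS]addr0 vn_lin vn_zero addr0. Qed.

Lemma vn_subr a x y : a (x - y) = a x - a y.
Proof. by rewrite vn_addr -scaleN1r vn_scale scaleN1r. Qed.

Lemma vn_ext a b : (forall x, a x = b x) -> a = b.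
Proof. by move=> ab; apply/val_inj/bop_ext. Qed.

Lemma rdot_star a x y : rdot (a x) y = rdot x (star a y).
Proof. by rewrite /rdot dot_star. Qed.

Lemma rdot_starl a x y : rdot (star a x) y = rdot x (a y).
Proof. by rewrite /rdot dot_starl. Qed.

Definition sq_bounded (K : R) a : Prop := forall x, sqn (a x) <= K * sqn x.

Lemma bounded_op_sqn (f : bounded_op H) :
  exists2 K : R, 0 <= K & forall x, sqn (f x) <= K * sqn x.
Proof.
have [_ [K fK]] := bop_bounded_op f.
(* A nonzero vector forces the complex bound to be a nonnegative real. *)
have [k k0 fk] : exists2 k : R, 0 <= k & forall x, `|f x| <= k%:C%C * `|x|.
  have [x x0] := vn_neq0 M.
  have x0' : 0 < `|x| by rewrite normr_gt0; apply/eqP.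
  have : 0 <= K * `|x| by rewrite (le_trans _ (fK x)).
  rewrite pmulr_lge0// => K0; move: K0 fK; case: K => k k'.
  by rewrite lecE/= => /andP[/eqP -> k0] fk; exists k.
exists (k ^+ 2) => [|x]; first exact: sqr_ge0.
have : `|f x| ^+ 2 <= (k%:C%C * `|x|) ^+ 2.
  by rewrite lerXn2r ?nnegrE// mulr_ge0// lecR.
by rewrite exprMn !norm_sqn -rmorphXn/= -rmorphM/= lecR.
Qed.

Lemma vn_bounded a : exists2 K : R, 0 <= K & sq_bounded K a.
Proof. exact: bounded_op_sqn. Qed.

Lemma vn_commutant a (b : bounded_op H) x :
  commutant (vn_set M) b -> a (b x) = b (a x).
Proof.
move=> /(_ _ (vn_set_val a)) /(congr1 (fun f : bounded_op H => f x)).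
by rewrite !bopM.
Qed.

(** This is how new elements of the algebra arise: by the bicommutant property
    it is enough to commute with the commutant. *)
Lemma vn_of_fun (f : H -> H) (K : R) : linear f ->
  (forall x, sqn (f x) <= K * sqn x) ->
  (forall b : bounded_op H, commutant (vn_set M) b ->
     forall x, f (b x) = b (f x)) ->
  exists a, forall x, a x = f x.
Proof.
move=> lf fK fM.
have fb : f \in bounded_op_pred (H := H).
  apply/asboolP; split => //; exists (Num.sqrt `|K|)%:C%C => x.
  rewrite -(ler_pXn2r (_ : 0 < 2)%N)// ?nnegrE//; last first.
    by rewrite mulr_ge0// lecR sqrtr_ge0.
  rewrite exprMn !norm_sqn -rmorphXn/= -rmorphM/= lecR sqr_sqrtr//.
  by rewrite (le_trans (fK x))// ler_wpM2r ?sqn_ge0// ler_norm.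
have fv : vn_set M (BoundedOp fb).
  rewrite -vn_bicommutant => b bM.
  apply: bop_ext => x; rewrite bopM [RHS]bopM. exact: fM.
by exists (VNElt (asboolT fv)).
Qed.

Lemma strong_limit (x : nat -> vn_elt M) (K : R) :
  (forall n, sq_bounded K (x n)) ->
  (forall v, exists l, hlim (fun n => x n v) l) ->
  exists2 a : vn_elt M,
    (forall v, hlim (fun n => x n v) (a v)) & sq_bounded K a.
Proof.
move=> xK xl; pose f v := projT1 (cid (xl v)).
have fP v : hlim (fun n => x n v) (f v) by exact: projT2 (cid (xl v)).
have fK v : sqn (f v) <= K * sqn v.
  by apply: (@hlim_sqn_le _ _ 0%N _ _ _ (fP v)) => n _; exact: xK.
have lf : linear f.
  move=> k u v; apply: (hlim_unique (fP (k *: u + v))).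
  have := hlimD (hlimZ k (fP u)) (fP v).
  by congr hlim; apply/funext => n; rewrite vn_lin.
have fM (b : bounded_op H) :
    commutant (vn_set M) b -> forall v, f (b v) = b (f v).
  move=> bM v; have [L _ bL] := bounded_op_sqn b.
  apply: (@hlim_unique _ _ (fun n => x n (b v))) => //.
  rewrite (_ : (fun _ => _) = b \o (fun n => x n v)); last first.
    by apply/funext => n /=; rewrite vn_commutant.
  apply: hlim_comp (fP v) => //; move=> u w.
  have h := bop_linear b (-1) w u.
  by rewrite [u - w]addrC -scaleN1r h scaleN1r addrC.
have [a af] := vn_of_fun lf fK fM.
by exists a => v; rewrite af.
Qed.

(** Polarization. *)
Lemma quadratic_form_eq0 a : (forall x, dot (a x) x = 0) -> a = 0.
Proof.
move=> a0; apply: vn_ext => x; apply: dot_ext => y; rewrite vn0 dot0l.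
have := a0 (x + y); rewrite vn_addr dotDl !dotDr !a0 addr0 add0r => e1.
have := a0 (x + 'i%C *: y).
rewrite vn_addr vn_scale dotDl !dotDr !dotZl !dotZr !a0 !mulr0 addr0 add0r.
have -> : dot (a y) x = - dot (a x) y by apply/eqP; rewrite -addr_eq0 addrC e1.
case: (dot (a x) y) => u v /= [] h1 h2.
by congr (_ +i* _)%C; lra.
Qed.

Lemma self_adjoint_dot a x : star a = a -> dot (a x) x = (rdot (a x) x)%:C%C.
Proof.
move=> sa; have : dot (a x) x = ((dot (a x) x)^*)%R.
  by rewrite -dot_conj -{1}sa dot_starl.
by rewrite /rdot; case: (dot (a x) x) => u v /= [] h; congr (_ +i* _)%C; lra.
Qed.

Lemma op_ge0_star a : op_ge0 a -> star a = a.
Proof.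
move=> a0; apply/esym/subr0_eq/quadratic_form_eq0 => x.
rewrite vnB dotBl dot_starl [dot x _]dot_conj; have := a0 x.
case: (dot (a x) x) => u v; rewrite lecE/= => /andP[/eqP -> _].
by congr (_ +i* _)%C; lra.
Qed.

Lemma op_ge0P a : op_ge0 a <-> star a = a /\ forall x, 0 <= rdot (a x) x.
Proof.
split=> [a0|[sa a0] x]; last by rewrite self_adjoint_dot// lecR.
split=> [|x]; first exact: op_ge0_star.
by have := a0 x; rewrite self_adjoint_dot ?lecR//; exact: op_ge0_star.
Qed.

Lemma op_ge0_rdot a x : op_ge0 a -> 0 <= rdot (a x) x.
Proof. by move=> /op_ge0P[]. Qed.

Lemma op_ge0_zero : op_ge0 (0 : vn_elt M).
Proof. by move=> x; rewrite vn0 dot0l. Qed.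

Lemma op_ge0_one : op_ge0 (1 : vn_elt M).
Proof. by move=> x; rewrite vn1 dot_ge0. Qed.

Lemma op_ge0D a b : op_ge0 a -> op_ge0 b -> op_ge0 (a + b).
Proof. by move=> a0 b0 x; rewrite vnD dotDl addr_ge0. Qed.

Lemma op_ge0Z (k : R) a : 0 <= k -> op_ge0 a -> op_ge0 (k%:C%C *: a).
Proof. by move=> k0 a0 x; rewrite vnZ dotZl mulr_ge0// lecR. Qed.

Lemma op_ge0_conj c a : op_ge0 a -> op_ge0 (star c * a * c).
Proof. by move=> a0 x; rewrite !vnM dot_starl a0. Qed.

Lemma op_ge0_sq c : op_ge0 (star c * c).
Proof. by move=> x; rewrite vnM dot_starl dot_ge0. Qed.

Lemma op_ge0_sum n (f : nat -> vn_elt M) :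
  (forall i, op_ge0 (f i)) -> op_ge0 (\sum_(i < n) f i).
Proof.
move=> f0; elim: n => [|n IH]; first by rewrite big_ord0; exact: op_ge0_zero.
by rewrite big_ord_recr/=; exact: op_ge0D.
Qed.

Lemma op_le_refl a : op_le a a.
Proof. by rewrite /op_le subrr; exact: op_ge0_zero. Qed.

Lemma op_le_trans b a c : op_le a b -> op_le b c -> op_le a c.
Proof. by move=> ab bc; rewrite /op_le -(subrK b c) -addrA; exact: op_ge0D. Qed.

Lemma op_le_rdot a b x : op_le a b -> rdot (a x) x <= rdot (b x) x.
Proof. by move=> /(op_ge0_rdot x); rewrite vnB rdotBl subr_ge0. Qed.

Lemma op_le_homo (a : nat -> vn_elt M) : (forall n, op_le (a n) (a n.+1)) ->
  forall m n, (m <= n)%N -> op_le (a m) (a n).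
Proof.
move=> aS m n /subnKC <-; elim: (n - m)%N => [|k IH].
  by rewrite addn0; exact: op_le_refl.
by rewrite addnS; exact: op_le_trans (aS _).
Qed.

Lemma op_leBl c a b : op_le a b -> op_le (c - b) (c - a).
Proof. by move=> ab; rewrite /op_le opprB addrC addrA subrK. Qed.

(** [a - a * a] is [a (1 - a) a + (1 - a) a (1 - a)]. *)
Lemma op_unit_sq a : op_ge0 a -> op_le a 1 -> op_le (a * a) a.
Proof.
move=> a0 a1; have sa := op_ge0_star a0.
have s1 : star (1 - a) = 1 - a by rewrite starB star1 sa.
rewrite /op_le (_ : a - a * a =
  star a * (1 - a) * a + star (1 - a) * a * (1 - a)).
  by apply: op_ge0D; apply: op_ge0_conj.
rewrite sa s1 !(mulrBl, mulrBr, mul1r, mulr1).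
by rewrite [RHS]addrC subrK.
Qed.

Lemma op_unit_sqn a x : op_ge0 a -> op_le a 1 -> sqn (a x) <= rdot (a x) x.
Proof.
move=> a0 a1; have := op_le_rdot x (op_unit_sq a0 a1).
by rewrite vnM -{1}(op_ge0_star a0) rdot_starl.
Qed.

Lemma op_unit_contraction a : op_ge0 a -> op_le a 1 -> sq_bounded 1 a.
Proof.
move=> a0 a1 x; rewrite mul1r; apply: (le_trans (op_unit_sqn x a0 a1)).
exact: op_le_rdot a1.
Qed.

Lemma scale_real (k l : R) a : k%:C%C *: (l%:C%C *: a) = (k * l)%:C%C *: a.
Proof. by rewrite scalerA -rmorphM. Qed.

Lemma star_scale_real (k : R) a : star (k%:C%C *: a) = k%:C%C *: star a.
Proof.
rewrite starZ; congr (_ *: _).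
by apply/eqP; rewrite eq_complex /= oppr0 !eqxx.
Qed.

Lemma star_real_scalar (k : R) : star (k%:C%C%:A) = k%:C%C%:A :> vn_elt M.
Proof. by rewrite star_scale_real star1. Qed.

Lemma sq_boundedP (K : R) a :
  sq_bounded K a <-> op_le (star a * a) (K%:C%C%:A).
Proof.
have E x : rdot ((K%:C%C%:A - star a * a) x) x = K * sqn x - sqn (a x).
  by rewrite vnB vnZ vn1 rdotBl rdotZl vnM rdot_starl.
split=> [aK|/op_ge0P[_ aK] x]; last by have := aK x; rewrite E subr_ge0.
apply/op_ge0P; split=> [|x]; last by rewrite E subr_ge0.
by rewrite starB star_real_scalar starM starK.
Qed.

Lemma op_sq_eq0 a : star a * a = 0 -> a = 0.
Proof.
move=> a0; apply: vn_ext => x; apply: sqn_eq0.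
by rewrite /sqn -rdot_starl -vnM a0 vn0 rdot0l.
Qed.

(** The bound [rdot (a x) x <= (K + 1) sqn x] comes from Cauchy-Schwarz and
    [K <= (K + 1) ^ 2]. *)
Lemma op_form_bounded a :
  exists2 K : R, 0 < K & op_ge0 a -> op_le a K%:C%C%:A.
Proof.
have [K K0 aK] := vn_bounded a; exists (K + 1); first by lra.
move=> a0; apply/op_ge0P; split=> [|x].
  by rewrite starB star_real_scalar (op_ge0_star a0).
rewrite vnB vnZ vn1 rdotBl rdotZl -/(sqn x).
have := rdot_CS (a x) x; have := aK x; have := op_ge0_rdot x a0.
have := sqn_ge0 x; have := sqn_ge0 (a x); rewrite /sq_bounded.
set p := rdot _ _; set q := sqn (a x); set n := sqn x; nra.
Qed.

(** Rescale [a] below [1] and use [op_unit_sqn]; this replaces the square root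
    of [a]. *)
Lemma op_ge0_sqn a :
  op_ge0 a -> exists2 K : R, 0 < K & forall x, sqn (a x) <= K * rdot (a x) x.
Proof.
move=> a0; have [K K0 /(_ a0) aK] := op_form_bounded a; exists K => // x.
have Ki : 0 < K^-1 by rewrite invr_gt0.
have b0 : op_ge0 (K^-1%:C%C *: a) by apply: op_ge0Z; rewrite // ltW.
have b1 : op_le (K^-1%:C%C *: a) 1.
  have Ki1 : K^-1 * K = 1 by rewrite mulVf// gt_eqF.
  have := op_ge0Z (ltW Ki) aK.
  by rewrite /op_le scalerBr scale_real Ki1 scale1r.
have := op_unit_sqn x b0 b1; rewrite vnZ sqnZ rdotZl expr2 -mulrA ler_pM2l//.
by rewrite ler_pdivrMl.
Qed.

Lemma sq_boundedB (K : R) a b : sq_bounded K a -> sq_bounded K b ->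
  sq_bounded (4 * K) (a - b).
Proof.
move=> aK bK x; rewrite vnB; apply: (le_trans (sqnB_le _ _)).
by have := aK x; have := bK x; lra.
Qed.

Lemma sq_bounded_midpoint (K : R) a b : sq_bounded K a -> sq_bounded K b ->
  sq_bounded K (2^-1%:C%C *: (a + b)).
Proof.
move=> aK bK x; rewrite vnZ vnD sqnZ.
by have := sqnD_le (a x) (b x); have := aK x; have := bK x; lra.
Qed.

Lemma op_lower_bound a :
  exists2 L : R, 0 < L & forall x, - (L * sqn x) <= rdot (a x) x.
Proof.
have [K K0 aK] := vn_bounded a; exists (K + 1) => [|x]; first by lra.
have := rdot_CS (a x) x; have := aK x; have := sqn_ge0 x.
have := sqn_ge0 (a x).
set p := rdot _ _; set q := sqn (a x); set n := sqn x; nra.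
Qed.

Lemma op_ge0_add_scalar (k : R) a : star a = a ->
  (op_ge0 (k%:C%C%:A + a) <-> forall x, - (k * sqn x) <= rdot (a x) x).
Proof.
move=> sa; have E x : rdot ((k%:C%C%:A + a) x) x = k * sqn x + rdot (a x) x.
  by rewrite vnD vnZ vn1 rdotDl rdotZl.
split=> [/op_ge0P[_ ka] x|ka].
  by have := ka x; rewrite E; lra.
apply/op_ge0P; split=> [|x]; first by rewrite starD star_real_scalar sa.
by rewrite E; have := ka x; lra.
Qed.

(** By positivity of [s] at [x n - l], the form of [s] at [l] satisfies
    [2 rdot (x n) (s l) <= rdot (s (x n)) (x n) + rdot (s l) l], whose left
    side is continuous in [x n]. *)
Lemma form_limit_le (s : vn_elt M) (x : nat -> H) l (B : R) N : op_ge0 s ->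
  hlim x l -> (forall n, (N <= n)%N -> rdot (s (x n)) (x n) <= B) ->
  rdot (s l) l <= B.
Proof.
move=> s0 xl xB.
have /cvgr_to_le h : 2 * rdot (x n) (s l) @[n --> \oo] --> 2 * rdot l (s l).
  by apply: cvgM; [exact: cvg_cst | exact: hlim_rdot].
have : 2 * rdot l (s l) <= B + rdot (s l) l.
  apply: h; exists N => // n /= Nn; have := xB n Nn.
  have := op_ge0_rdot (x n - l) s0.
  rewrite vn_subr rdotBl !rdotBr (rdot_star s (x n) l) (op_ge0_star s0).
  rewrite (rdotC (s l) (x n)); lra.
rewrite rdotC; lra.
Qed.

(** The differences [d = a n - a m] lie between [0] and [1], so
    [sqn (d x) <= rdot (d x) x], and the real sequences [rdot (a n x) x] are
    monotone and bounded, hence Cauchy. *)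
Lemma monotone_limit (a : nat -> vn_elt M) : (forall n, op_ge0 (a n)) ->
  (forall n, op_le (a n) 1) -> (forall n, op_le (a n) (a n.+1)) ->
  exists l : vn_elt M, [/\ forall x, hlim (fun n => a n x) (l x),
    op_ge0 l, op_le l 1 & op_is_lub (range a) l].
Proof.
move=> a0 a1 aS.
have aK n : sq_bounded 1 (a n) by exact: op_unit_contraction.
have ale := op_le_homo aS.
have [x|l al lK] := strong_limit aK.
  pose u n := rdot (a n x) x.
  have u_nd : nondecreasing_seq u.
    by move=> m n mn; apply: op_le_rdot; exact: ale.
  have /(nondecreasing_cvgn u_nd) : has_ubound (range u).
    by exists (sqn x) => _ [n _ <-]; exact: (op_le_rdot x (a1 n)).
  move: (sup _) => L uL; apply: hlim_cauchy => e e0.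
  have e2 : 0 < e / 2 by lra.
  have /cvgrPdist_le/(_ _ e2)[N _ NP] := uL.
  have step m n : (N <= m <= n)%N -> sqn (a n x - a m x) <= e.
    move=> /andP[Nm mn]; rewrite -vnB.
    have d0 : op_ge0 (a n - a m) by exact: ale.
    have d1 : op_le (a n - a m) 1.
      rewrite /op_le opprB addrA addrAC; apply: op_ge0D => //; exact: a1.
    apply: (le_trans (op_unit_sqn x d0 d1)); rewrite vnB rdotBl.
    have := NP m Nm; have := NP n (leq_trans Nm mn).
    rewrite /= -/(u n) -/(u m) !ler_norml => /andP[? ?] /andP[? ?]; lra.
  exists N => m n Nm Nn; have [mn|/ltnW nm] := leqP m n.
    by rewrite sqnBC step// Nm.
  by rewrite step// Nn.
have lsa : star l = l.
  apply: vn_ext => x; apply: sqn_ext => y; rewrite rdot_starl rdotC.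
  have h1 := hlim_rdot (y := x) (al y); have h2 := hlim_rdot (y := y) (al x).
  move: h1; rewrite (_ : (fun n => rdot (a n y) x) = (fun n => rdot (a n x) y)).
    by move=> h1; exact: (cvg_unique (@norm_hausdorff R R) h1 h2).
  by apply/funext => n; rewrite rdot_star op_ge0_star// rdotC.
have up n : op_le (a n) l.
  apply/op_ge0P; split=> [|x]; first by rewrite starB lsa op_ge0_star.
  rewrite vnB rdotBl subr_ge0; apply: (cvgr_to_ge (hlim_rdot (y := x) (al x))).
  by exists n => // m /= nm; apply: op_le_rdot; exact: ale.
have least t : (forall n, op_le (a n) t) -> op_le l t.
  move=> at_; apply/op_ge0P; split=> [|x].
    have := op_ge0_star (at_ 0%N); rewrite starB (op_ge0_star (a0 0%N)).
    by move=> /addIr st; rewrite starB lsa st.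
  rewrite vnB rdotBl subr_ge0; apply: (cvgr_to_le (hlim_rdot (y := x) (al x))).
  by apply: nearW => n; exact: op_le_rdot.
exists l; split => //.
- by have := op_ge0D (a0 0%N) (up 0%N); rewrite addrC subrK.
- exact: least.
- split=> [_ [n _ <-]//|t tP]; apply: least => n; apply: tP; by exists n.
Qed.

Lemma unitary_sqn (v : vn_elt M) x : Defs.is_unitary v -> sqn (v x) = sqn x.
Proof. by case=> vv _; rewrite /sqn -rdot_starl -vnM vv. Qed.

Lemma unitary_star (v : vn_elt M) :
  Defs.is_unitary v -> Defs.is_unitary (star v).
Proof. by case=> uu uv; split; rewrite starK. Qed.

Lemma sq_bounded_conj (K : R) (u v c : vn_elt M) :
  Defs.is_unitary u -> Defs.is_unitary v ->
  sq_bounded K c -> sq_bounded K (u * c * star v).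
Proof.
move=> uU vU cK x; rewrite !vnM unitary_sqn//.
by rewrite (le_trans (cK _))// unitary_sqn//; exact: unitary_star.
Qed.

End OperatorOrder.

(** * Resolvents of positive elements *)

Section Resolvent.
Variables (R : realType) (H : hilbertType R) (M : vnAlgebra H).
Implicit Types (a b c g s : vn_elt M) (x y : H).

Lemma sqn_le_one_plus s x : op_ge0 s -> sqn x <= sqn ((1 + s) x).
Proof.
move=> s0; have := op_ge0_rdot x s0; have := rdot_CS ((1 + s) x) x.
rewrite {1}vnD vn1 rdotDl -/(sqn x).
have := sqn_ge0 x; have := sqn_ge0 ((1 + s) x).
set p := rdot _ _; set q := sqn ((1 + s) x); set n := sqn x; nra.
Qed.

(** With [A = 1 + s] and [L >= 2] such that [sqn (A x) <= L sqn x], the map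
    [x |-> x - L^-1 (A x - z)] contracts squared distances by [1 - L^-1],
    because [rdot (A x) x >= sqn x]; its fixed point solves [A x = z]. *)
Lemma one_plus_surjective s z : op_ge0 s -> exists x, (1 + s) x = z.
Proof.
move=> s0; set A := 1 + s; have [L0 L00 AL] := vn_bounded A.
pose L := L0 + 2; have L2 : 2 <= L by rewrite /L; lra.
have L0' : 0 < L by lra.
have Li : 0 < L^-1 by rewrite invr_gt0.
pose T x := x - L^-1%:C%C *: A x; pose r := 1 - L^-1.
have r01 : 0 < r < 1.
  have : L^-1 < 1 by rewrite invf_lt1//; lra.
  by rewrite /r => ?; apply/andP; split; lra.
have TB x y : T x - T y = T (x - y).
  rewrite /T vn_subr scalerBr !opprB addrACA [RHS]addrACA.
  by rewrite [- (_ *: _) - y]addrC.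
have Tr x : sqn (T x) <= r * sqn x.
  rewrite /T sqnB sqnZ rdotZr rdotC {1}/A vnD vn1 rdotDl -/(sqn x).
  have := op_ge0_rdot x s0; have := AL x; have := sqn_ge0 x.
  set p := rdot _ _; set q := sqn (A x); set n := sqn x => n0 qL p0.
  have : L^-1 ^+ 2 * q <= L^-1 * n.
    rewrite expr2 -mulrA ler_pM2l// ler_pdivrMl//.
    by apply: (le_trans qL); rewrite ler_wpM2r// /L; lra.
  rewrite /r; have := mulr_ge0 (ltW Li) p0; have := mulr_ge0 (ltW Li) n0; lra.
pose y n := iter n (fun x => T x + L^-1%:C%C *: z) 0.
have yS n : y n.+1 = T (y n) + L^-1%:C%C *: z by [].
have yd n : sqn (y n.+1 - y n) <= sqn (y 1%N - y 0%N) * r ^+ n.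
  elim: n => [|n IH]; first by rewrite expr0 mulr1.
  rewrite (yS n.+1) {2}yS opprD addrACA subrr addr0 TB.
  apply: (le_trans (Tr _)); rewrite exprS mulrCA ler_wpM2l//.
  by case/andP: r01 => r0 _; exact: ltW.
have [l yl] := hlim_geometric r01 yd; exists l.
have [K _ AK] := vn_bounded A.
have lim1 : hlim (fun n => A (y n) - z) (A l - z).
  apply: hlimB; last exact: hlim_cst.
  by apply: (hlim_comp (K := K)) yl => // u v; rewrite vn_subr.
have lim0 : hlim (fun n => A (y n) - z) 0.
  apply: (@cvg0_le _ _ (fun n => L ^+ 2 * sqn (y 1%N - y 0%N) * r ^+ n)).
    move=> n; rewrite sqn_ge0 subr0 -mulrA.
    have -> : A (y n) - z = (- L)%:C%C *: (y n.+1 - y n).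
      have LLi : L * L^-1 = 1 by rewrite divff// gt_eqF.
      have -> : y n.+1 - y n = L^-1%:C%C *: (z - A (y n)).
        by rewrite yS /T scalerBr addrAC [y n - _]addrC addrK addrC.
      rewrite scalerA -rmorphM mulNr LLi rmorphN1.
      by rewrite scaleN1r opprB.
    by rewrite sqnZ sqrrN ler_wpM2l// sqr_ge0.
  exact: cvg0_geometric.
exact/subr0_eq/(hlim_unique lim1 lim0).
Qed.

Lemma one_plus_invertible s : op_ge0 s ->
  exists g, g * (1 + s) = 1 /\ (1 + s) * g = 1.
Proof.
move=> s0.
have inj x y : (1 + s) x = (1 + s) y -> x = y.
  move=> xy; apply/subr0_eq/sqn_eq0/eqP; rewrite eq_le sqn_ge0 andbT.
  apply: (le_trans (sqn_le_one_plus _ s0)).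
  by rewrite vn_subr xy subrr sqn0.
pose f z := projT1 (cid (one_plus_surjective z s0)).
have fP z : (1 + s) (f z) = z by exact: projT2 (cid (one_plus_surjective z s0)).
have lf : linear f by move=> k x y; apply: inj; rewrite vn_lin !fP.
have fK x : sqn (f x) <= 1 * sqn x.
  by rewrite mul1r -{2}(fP x) sqn_le_one_plus.
have [|g gf] := @vn_of_fun _ _ M f 1 lf fK.
  by move=> b bM x; apply: inj; rewrite fP vn_commutant// fP.
exists g; split; apply: vn_ext => x.
  by rewrite vnM gf vn1; apply: inj; rewrite fP.
by rewrite vnM gf vn1 fP.
Qed.

(** The resolvent [(1 + s)^-1], made total so that sequences of resolvents can
    be written without proofs of positivity. *)
Definition res s : vn_elt M :=
  xget 0 [set g | g * (1 + s) = 1 /\ (1 + s) * g = 1].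

Lemma resP s : op_ge0 s -> res s * (1 + s) = 1 /\ (1 + s) * res s = 1.
Proof. by move=> /one_plus_invertible; exact: (@xgetPex _ 0). Qed.

Lemma res_mul s : op_ge0 s -> s * res s = 1 - res s /\ res s * s = 1 - res s.
Proof.
move=> /resP; rewrite mulrDr mulrDl mulr1 mul1r => -[gs sg].
by split; [rewrite -sg | rewrite -gs]; rewrite addrC addKr.
Qed.

Lemma res_ge0 s : op_ge0 s -> op_ge0 (res s).
Proof.
move=> s0 x; have [_ sr] := resP s0.
have xE : x = (1 + s) (res s x) by rewrite -vnM sr vn1.
rewrite [X in dot _ X]xE dot_conj conjC_ge0.
exact: (op_ge0D (@op_ge0_one _ _ M) s0).
Qed.

(** The difference [s - (1 - res s)] is [s * res s * s]. *)
Lemma op_le_one_res s : op_ge0 s -> op_le (1 - res s) s.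
Proof.
move=> s0; have [sg gs] := res_mul s0.
have := op_ge0_conj s (res_ge0 s0); rewrite (op_ge0_star s0) /op_le.
by rewrite sg mulrBl mul1r gs.
Qed.

(** For [g = res s], [1 - g] is [g * s * g + star (s * g) * (s * g)], as
    [g * (1 + s) = 1]. *)
Lemma res_le1 s : op_ge0 s -> op_le (res s) 1.
Proof.
move=> s0; have [sg gs] := res_mul s0; have [_ Ag] := resP s0.
have sas := op_ge0_star s0; have sag := op_ge0_star (res_ge0 s0).
rewrite /op_le (_ : 1 - res s =
  star (res s) * s * res s + star (s * res s) * (s * res s)).
  by apply: op_ge0D; [exact: op_ge0_conj | exact: op_ge0_sq].
rewrite starM sas sag -[_ * s * (s * _)]mulrA -mulrA -mulrDr.
rewrite -{1}[s * res s]mul1r -mulrDl mulrA.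
by have [-> _] := resP s0; rewrite mul1r sg.
Qed.

(** With [A = 1 + s], [B = 1 + t] and inverses [g], [h], the difference
    [g - h] is [(g - h) A (g - h) + h (B - A) h]. *)
Lemma res_antitone s t : op_ge0 s -> op_le s t -> op_le (res t) (res s).
Proof.
move=> s0 st.
have t0 : op_ge0 t by have := op_ge0D s0 st; rewrite addrC subrK.
have [gA Ag] := resP s0; have [hB Bh] := resP t0.
have sag := op_ge0_star (res_ge0 s0); have sah := op_ge0_star (res_ge0 t0).
move: gA Ag hB Bh sag sah; set g := res s; set h := res t.
set A := 1 + s; set B := 1 + t => gA Ag hB Bh sag sah.
have A0 : op_ge0 A by apply: op_ge0D => //; exact: op_ge0_one.
rewrite /op_le (_ : g - h =
  star (g - h) * A * (g - h) + star h * (t - s) * h).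
  by apply: op_ge0D; exact: op_ge0_conj.
rewrite starB sag sah (_ : t - s = B - A); last first.
  by rewrite /B /A opprD addrACA subrr add0r.
rewrite [(g - h) * A]mulrBl gA mulrBl mul1r mulrBr [h * (B - A)]mulrBr hB.
rewrite mulrBl mul1r -[h * A * g]mulrA Ag mulr1.
by rewrite subrK.
Qed.

(** This is the point of the resolvent: however large [s] is, its form stays
    bounded on the range of [res s]. *)
Lemma res_form s x : op_ge0 s -> rdot (s (res s x)) (res s x) <= sqn x.
Proof.
move=> s0; have [_ sr] := resP s0.
have : rdot ((1 + s) (res s x)) (res s x) <= sqn x.
  by rewrite -vnM sr vn1 rdotC; exact: (op_le_rdot x (res_le1 s0)).
by rewrite vnD vn1 rdotDl; have := sqn_ge0 (res s x); rewrite /sqn; lra.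
Qed.

Lemma scalar_add_invertible (k : R) s : 0 < k -> op_ge0 s ->
  exists b, b * (k%:C%C%:A + s) = 1.
Proof.
move=> k0 s0; have ki0 : 0 <= k^-1 by rewrite invr_ge0 ltW.
have [gA _] := resP (op_ge0Z ki0 s0).
exists (res (k^-1%:C%C *: s) * k^-1%:C%C%:A); rewrite -mulrA -scalerAl mul1r.
by rewrite scalerDr !scale_real mulVf ?gt_eqF// scale1r.
Qed.

End Resolvent.

(** * Faithful normal traces *)

Section FaithfulNormalTrace.
Variables (R : realType) (H : hilbertType R) (M : vnAlgebra H).

(** The real part of a faithful normal trace, with normality for increasing
    sequences only.  In this form traces can be added and composed with
    automorphisms, as the proof of uniqueness of the trace requires. *)
Record ntrace := NTrace {
  nt :> vn_elt M -> R ;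
  ntD : forall a b, nt (a + b) = nt a + nt b ;
  ntZ : forall (k : R) a, nt (k%:C%C *: a) = k * nt a ;
  nt_ge0 : forall a, op_ge0 a -> 0 <= nt a ;
  ntC : forall a b, nt (a * b) = nt (b * a) ;
  nt_star : forall a, nt (star a) = nt a ;
  nt_faithful : forall a, op_ge0 a -> nt a = 0 -> a = 0 ;
  nt_normal : forall (a : nat -> vn_elt M) l, (forall n, op_ge0 (a n)) ->
    (forall n, op_le (a n) (a n.+1)) -> op_is_lub (range a) l ->
    nt (a n) @[n --> \oo] --> nt l
}.

Variable t : ntrace.
Implicit Types (a b c : vn_elt M).

Lemma nt0 : t 0 = 0.
Proof. by apply: (addrI (t 0)); rewrite -ntD !addr0. Qed.

Lemma ntN a : t (- a) = - t a.
Proof. by apply: (addrI (t a)); rewrite -ntD !subrr nt0. Qed.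

Lemma ntB a b : t (a - b) = t a - t b.
Proof. by rewrite ntD ntN. Qed.

Lemma nt_le a b : op_le a b -> t a <= t b.
Proof. by move=> /(nt_ge0 t); rewrite ntB subr_ge0. Qed.

Definition sq2 a : R := t (star a * a).

Lemma sq2_ge0 a : 0 <= sq2 a.
Proof. exact/nt_ge0/op_ge0_sq. Qed.

Lemma sq2_eq0 a : sq2 a = 0 -> a = 0.
Proof. by move=> /(nt_faithful (op_ge0_sq a)); exact: op_sq_eq0. Qed.

Lemma sq2_star a : sq2 (star a) = sq2 a.
Proof. by rewrite /sq2 starK ntC. Qed.

Lemma sq2N a : sq2 (- a) = sq2 a.
Proof. by rewrite /sq2 starN mulrNN. Qed.

Lemma sq2BC a b : sq2 (a - b) = sq2 (b - a).
Proof. by rewrite -sq2N opprB. Qed.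

Lemma sq2_parallelogram a b :
  sq2 (a + b) + sq2 (a - b) = 2 * sq2 a + 2 * sq2 b.
Proof.
rewrite /sq2 starB starD !(mulrBl, mulrBr, mulrDl, mulrDr) !(ntB, ntD); ring.
Qed.

Lemma sq2D_le a b : sq2 (a + b) <= 2 * sq2 a + 2 * sq2 b.
Proof. by have := sq2_ge0 (a - b); have := sq2_parallelogram a b; lra. Qed.

Lemma sq2B_le a b : sq2 (a - b) <= 2 * sq2 a + 2 * sq2 b.
Proof. by have := sq2_ge0 (a + b); have := sq2_parallelogram a b; lra. Qed.

Lemma sq2Z (k : R) a : sq2 (k%:C%C *: a) = k ^+ 2 * sq2 a.
Proof. by rewrite /sq2 star_scale_real -scalerAl -scalerAr !ntZ mulrA. Qed.

Lemma sq2_midpoint a b : sq2 (2^-1%:C%C *: (a + b)) <= (sq2 a + sq2 b) / 2.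
Proof. by rewrite sq2Z; have := sq2D_le a b; lra. Qed.

Lemma sq2M_le (K : R) a b : sq_bounded K a -> sq2 (a * b) <= K * sq2 b.
Proof.
move=> /sq_boundedP/(op_ge0_conj b)/(nt_ge0 t).
rewrite mulrBr mulrBl mulr_algr -scalerAl ntB ntZ subr_ge0.
by rewrite /sq2 starM !mulrA.
Qed.

Lemma sq2_unitl u a : star u * u = 1 -> sq2 (u * a) = sq2 a.
Proof. by move=> uu; rewrite /sq2 starM mulrA -(mulrA _ _ u) uu mulr1. Qed.

Lemma sq2_unitr u a : u * star u = 1 -> sq2 (a * u) = sq2 a.
Proof.
by move=> uu; rewrite -sq2_star starM sq2_unitl ?starK// sq2_star.
Qed.

Lemma sq2_le_nt a : op_ge0 a -> op_le a 1 -> sq2 a <= t a.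
Proof.
by move=> a0 a1; rewrite /sq2 op_ge0_star//; apply/nt_le/op_unit_sq.
Qed.

Lemma sq2_sub_scalar (k : R) a :
  sq2 (a - k%:C%C%:A) = sq2 a - 2 * k * t a + k ^+ 2 * t 1.
Proof.
rewrite /sq2 starB star_real_scalar mulrBl !mulrBr !mulr_algl mulr_algr.
by rewrite scale_real !ntB !ntZ nt_star; ring.
Qed.

(** Expand [sq2 (a - k) >= 0] at the optimal scalar [k = t a / t 1]. *)
Lemma nt_sq_le a : t a ^+ 2 <= t 1 * sq2 a.
Proof.
have t10 : 0 <= t 1 by exact/nt_ge0/op_ge0_one.
have [t1|t1] := eqVneq (t 1) 0.
  have := nt_faithful (@op_ge0_one _ _ M) t1 => e.
  by rewrite -[a]mulr1 e mulr0 nt0 expr0n mulr_ge0// sq2_ge0.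
have {t1} t1 : 0 < t 1 by rewrite lt_def t1.
have := sq2_ge0 (a - (t a / t 1)%:C%C%:A).
rewrite sq2_sub_scalar (_ : _ + _ = sq2 a - t a ^+ 2 / t 1); last first.
  by field; rewrite gt_eqF.
by rewrite subr_ge0 ler_pdivrMr// mulrC.
Qed.

End FaithfulNormalTrace.

(** * Completeness of bounded sets in the 2-norm *)

Section Completeness.
Variables (R : realType) (H : hilbertType R) (M : vnAlgebra H) (t : ntrace M).
Implicit Types (a b c : vn_elt M).

Lemma invr_half_expn j : (2^-1 ^+ j : R) * 2 ^+ j = 1.
Proof. by rewrite -exprMn mulVf ?expr1n// pnatr_eq0. Qed.

Lemma half_expn_gt0 j : 0 < (2^-1 ^+ j : R).
Proof. by rewrite exprn_gt0// invr_gt0. Qed.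

(** [r j] is the limit in [n] of the resolvents of [2 ^ - j s n].  Each [r j]
    tames all the [s n] simultaneously by [res_form]; since
    [1 - res s <= s], normality gives the bound on [t (1 - r j)]; and the [r j]
    increase with [j] to an element [e <= 1] with [t (1 - e) = 0], which is [1]
    as [t] is faithful. *)
Lemma approximate_unit (s : nat -> vn_elt M) (B : R) :
  (forall n, op_ge0 (s n)) -> (forall n, op_le (s n) (s n.+1)) ->
  (forall n, t (s n) <= B) ->
  exists r : nat -> vn_elt M,
    [/\ forall j, op_ge0 (r j), forall j, op_le (r j) 1,
        forall j, t (1 - r j) <= 2^-1 ^+ j * B,
        forall x, hlim (fun j => r j x) x &
        forall j n x, rdot (s n (r j x)) (r j x) <= 2 ^+ j * sqn x].
Proof.
move=> s0 sS sB; pose lam j : R := 2^-1 ^+ j.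
have lam0 j : 0 < lam j by exact: half_expn_gt0.
pose ls j n := (lam j)%:C%C *: s n.
have ls0 j n : op_ge0 (ls j n) by apply: op_ge0Z; rewrite // ltW.
have lsS j n : op_le (ls j n) (ls j n.+1).
  by rewrite /op_le -scalerBr; apply: op_ge0Z; rewrite ?ltW//; exact: sS.
pose a j n := 1 - res (ls j n).
have ale j n : op_le (a j n) (ls j n) by exact: op_le_one_res.
have /choice[L LP] : forall j, exists l : vn_elt M,
    [/\ forall x, hlim (fun n => a j n x) (l x), op_ge0 l, op_le l 1 &
        op_is_lub (range (a j)) l].
  move=> j; apply: monotone_limit => n.
  - exact: res_le1.
  - by rewrite /op_le /a subKr; exact: res_ge0.
  - by apply: op_leBl; exact: res_antitone.
pose r j := 1 - L j.
have r0 j : op_ge0 (r j) by have [] := LP j.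
have r1 j : op_le (r j) 1 by rewrite /op_le /r subKr; have [] := LP j.
have tr1 j : t (1 - r j) <= 2^-1 ^+ j * B.
  have [_ _ _ Llub] := LP j; rewrite /r subKr.
  have Llim : t (a j n) @[n --> \oo] --> t (L j).
    apply: nt_normal Llub => n; first exact: res_le1.
    by apply: op_leBl; exact: res_antitone.
  apply: (cvgr_to_le Llim).
  apply: nearW => n; apply: (le_trans (nt_le t (ale j n))).
  by rewrite ntZ ler_wpM2l// ltW.
have rS j : op_le (r j) (r j.+1).
  have [_ _ _ [Lup _]] := LP j; have [_ _ _ [_ Lleast]] := LP j.+1.
  have : op_le (L j.+1) (L j).
    apply: Lleast => _ [n _ <-]; apply: (@op_le_trans _ _ _ (a j n)).
      apply: op_leBl; apply: res_antitone => //.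
      rewrite /op_le /ls -scalerBl -rmorphB; apply: op_ge0Z => //.
      by rewrite /lam exprS; have := lam0 j; rewrite /lam; lra.
    by apply: Lup; exists n.
  exact: op_leBl.
have [e [re e0 e1 [eup _]]] := monotone_limit r0 r1 rS.
have e1E : 1 - e = 0.
  apply: (nt_faithful e1); apply/eqP; rewrite eq_le nt_ge0// andbT.
  apply: (cvgr_to_ge (@cvg0_geometric _ B (2^-1) _)).
    by apply/andP; split; lra.
  apply: nearW => j; rewrite mulrC; apply: le_trans (tr1 j).
  apply/nt_le/op_leBl/eup.
  by exists j.
exists r; split => // [x|j n x].
  by have := re x; move/subr0_eq: e1E => <-.
have rl : hlim (fun m => res (ls j m) x) (r j x).
  have [/(_ x) Ll _ _ _] := LP j.
  have := hlimB (hlim_cst x) Ll.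
  rewrite (_ : x - L j x = r j x)//; congr hlim; apply/funext => m.
  by rewrite /a vnB vn1 opprB addrC subrK.
apply: (form_limit_le (N := n) (s0 n) rl) => m nm.
have := res_form x (ls0 j m); rewrite {1}/ls vnZ rdotZl => h.
have := op_le_rdot (res (ls j m) x) (op_le_homo sS nm).
set p := rdot _ _; set q := rdot (s m _) _ in h * => pq.
have := invr_half_expn j; rewrite -/(lam j) => lamE.
have p2 : 0 < (2 : R) ^+ j by rewrite exprn_gt0.
have : 2 ^+ j * (lam j * q) <= 2 ^+ j * sqn x by rewrite ler_pM2l.
by rewrite mulrA [2 ^+ j * _]mulrC lamE mul1r; exact: le_trans.
Qed.

(** The weights [4 ^ i] keep [t (s n)] bounded while forcing [d n] to have norm
    of order [2 ^ - n] on the range of each [r j].  So [x n] converges strongly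
    on these ranges, whose union is dense because [r j] tends strongly to [1],
    and therefore everywhere, the [x n] being bounded.  For the 2-norm,
    [y - x n] is split as [(y - x n) r j + (y - x n) (1 - r j)] with [j = n]. *)
Theorem bounded_sq2_complete (x : nat -> vn_elt M) (K C : R) :
  (forall n, sq_bounded K (x n)) ->
  (forall n, sq2 t (x n.+1 - x n) <= C * 16^-1 ^+ n) ->
  exists y, sq2 t (y - x n) @[n --> \oo] --> (0 : R).
Proof.
move=> xK xC; pose d n := x n.+1 - x n.
have C0 : 0 <= C.
  by have := le_trans (sq2_ge0 t _) (xC 0%N); rewrite expr0 mulr1.
pose s N := \sum_(i < N) (4 ^+ i)%:C%C *: (star (d i) * d i).
have term_ge0 i : op_ge0 ((4 ^+ i)%:C%C *: (star (d i) * d i)).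
  by apply: op_ge0Z; [exact: exprn_ge0 | exact: op_ge0_sq].
have s0 n : op_ge0 (s n) by exact: (op_ge0_sum _ term_ge0).
have sE n : s n.+1 = s n + (4 ^+ n)%:C%C *: (star (d n) * d n).
  by rewrite /s big_ord_recr.
have sS n : op_le (s n) (s n.+1).
  by rewrite /op_le sE addrC addKr; exact: term_ge0.
(* The term of index n adds at most C 4^-n. *)
have ts n : t (s n) <= 2 * C * (1 - 4^-1 ^+ n).
  elim: n => [|n IH]; first by rewrite /s big_ord0 nt0 expr0 subrr mulr0.
  rewrite sE ntD ntZ -/(sq2 t _) exprS.
  have E : (4 : R) ^+ n * (C * 16^-1 ^+ n) = C * 4^-1 ^+ n.
    by rewrite mulrCA -exprMn; congr (_ * _ ^+ _); field.
  have : 4 ^+ n * sq2 t (d n) <= C * 4^-1 ^+ n.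
    by rewrite -E; apply: ler_wpM2l (xC n); exact: exprn_ge0.
  have : 0 <= C * 4^-1 ^+ n by rewrite mulr_ge0// exprn_ge0.
  set w := 4^-1 ^+ n in IH *; nra.
have ts2 n : t (s n) <= 2 * C.
  apply: (le_trans (ts n)).
  have : 0 <= C * 4^-1 ^+ n by rewrite mulr_ge0// exprn_ge0.
  set w := 4^-1 ^+ n; lra.
have [r [r0 r1 tr1 rl rs]] := approximate_unit s0 sS ts2.
have step j v n :
    sqn (x n.+1 (r j v) - x n (r j v)) <= 2 ^+ j * sqn v * 4^-1 ^+ n.
  rewrite -vnB -/(d n); have := rs j n.+1 v.
  rewrite sE vnD rdotDl vnZ rdotZl vnM rdot_starl -/(sqn _) => h.
  have := op_ge0_rdot (r j v) (s0 n) => h1.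
  have {}h : 4 ^+ n * sqn (d n (r j v)) <= 2 ^+ j * sqn v by lra.
  have n4 : 0 < (4 : R) ^+ n by rewrite exprn_gt0.
  by rewrite exprVn mulrC ler_pdivlMl.
have r4 : 0 < (4^-1 : R) < 1 by apply/andP; split; lra.
have tail j v n k :
    sqn (x (n + k)%N (r j v) - x n (r j v)) <= 5 * (2 ^+ j * sqn v) * 4^-1 ^+ n.
  apply: (le_trans (geometric_step r4 (step j v) k n)).
  rewrite ler_wpM2r ?exprn_ge0//.
  have : 0 <= 2 ^+ j * sqn v by rewrite mulr_ge0 ?sqn_ge0// exprn_ge0.
  set w := 2 ^+ j * _ => w0.
  have -> : 2 * w * (1 + 4^-1) / (1 - 4^-1) ^+ 2 = 40 / 9 * w by field.
  lra.
have xlim v : exists l, hlim (fun n => x n v) l.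
  apply: hlim_cauchy => e e0.
  pose K' := `|K| + 1; have K'0 : 0 < K' by rewrite ltr_wpDl.
  have KK' : K <= K' by rewrite /K'; have := ler_norm K; lra.
  have e1 : 0 < e / (16 * K') by rewrite divr_gt0// mulr_gt0.
  have /cvgrPdist_le/(_ _ e1)[j _ /(_ j (leqnn j))/=] := rl v.
  rewrite sub0r normrN ger0_norm ?sqn_ge0// => rj.
  have e2 : 0 < e / 8 by lra.
  have /cvgrPdist_le/(_ _ e2)[N _ NP] :=
    cvg0_geometric (5 * (2 ^+ j * sqn v)) r4.
  have close m n : (N <= n <= m)%N -> sqn (x m v - x n v) <= e.
    move=> /andP[Nn nm].
    pose w : vn_elt M := x m - x n.
    have wE z : w z = x m z - x n z by [].
    have -> : x m v - x n v = w (r j v) - w (r j v - v).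
      by rewrite -vn_subr subKr wE.
    apply: (le_trans (sqnB_le _ _)).
    have h1 := sq_boundedB (xK m) (xK n) (r j v - v).
    have {}h1 : sqn (w (r j v - v)) <= e / 4.
      apply: (le_trans h1); apply: (@le_trans _ _ (4 * K' * sqn (r j v - v))).
        by rewrite ler_wpM2r ?sqn_ge0//; lra.
      have := ler_wpM2l (ltW (mulr_gt0 (ltr0n R 4) K'0)) rj.
      by rewrite (_ : _ * (e / _) = e / 4)//; field; rewrite gt_eqF.
    have h2 := tail j v n (m - n)%N; rewrite subnKC// in h2.
    have := NP n Nn; rewrite /= sub0r normrN => /(le_trans (ler_norm _)) h3.
    rewrite -wE in h2; lra.
  exists N => m n Nm Nn; have [mn|/ltnW nm] := leqP m n.
    by rewrite sqnBC close// Nm.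
  by rewrite close// Nn.
have [y xy yK] := strong_limit xK xlim; exists y.
have far j n : sq2 t (y - x n) <=
    10 * 2 ^+ j * 4^-1 ^+ n * t 1 + 16 * `|K| * C * 2^-1 ^+ j.
  have -> : y - x n = (y - x n) * r j + (y - x n) * (1 - r j).
    by rewrite mulrBr mulr1 [RHS]addrC subrK.
  apply: (le_trans (sq2D_le _ _ _)).
  have h1 : sq_bounded (5 * 2 ^+ j * 4^-1 ^+ n) ((y - x n) * r j).
    move=> v; rewrite vnM vnB.
    apply: (hlim_sqn_le (N := n) (hlimB (xy (r j v)) (hlim_cst (x n (r j v))))).
    move=> m nm; have := tail j v n (m - n)%N; rewrite subnKC//.
    by rewrite mulrA [5 * _ * _ * _]mulrAC.
  have t1 : sq2 t 1 = t 1 by rewrite /sq2 star1 mulr1.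
  have := sq2M_le t 1 h1; rewrite mulr1 t1 => h2.
  have r1' : op_le (1 - r j) 1 by rewrite /op_le subKr.
  have h3 := le_trans (sq2_le_nt t (r1 j) r1') (tr1 j).
  have h4 := sq2M_le t (1 - r j) (sq_boundedB yK (xK n)).
  have h5 : 4 * K * sq2 t (1 - r j) <= 4 * `|K| * (2^-1 ^+ j * (2 * C)).
    apply: (@le_trans _ _ (4 * `|K| * sq2 t (1 - r j))).
      by rewrite ler_wpM2r ?sq2_ge0// ler_wpM2l// ler_norm.
    by rewrite ler_wpM2l// mulr_ge0.
  lra.
apply: (@cvg0_le _ _ (fun n => (10 * t 1 + 16 * `|K| * C) * 2^-1 ^+ n)).
  move=> n; rewrite sq2_ge0/=; apply: (le_trans (far n n)).
  have -> : (10 : R) * 2 ^+ n * 4^-1 ^+ n = 10 * 2^-1 ^+ n.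
    by rewrite -mulrA -exprMn; congr (_ * _ ^+ _); field.
  set w := 2^-1 ^+ n; lra.
by apply: cvg0_geometric; apply/andP; split; lra.
Qed.

End Completeness.

(** * Automorphisms *)

Section StarAutTheory.
Variables (R : realType) (H : hilbertType R) (M : vnAlgebra H).
Variables (f : vn_elt M -> vn_elt M) (fA : is_star_aut f).
Implicit Types (a b c v y : vn_elt M).

Lemma autM a b : f (a * b) = f a * f b.
Proof. exact: star_autM fA a b. Qed.

Lemma aut_star a : f (star a) = star (f a).
Proof. exact: star_aut_star fA a. Qed.

Lemma autD a b : f (a + b) = f a + f b.
Proof. by have := star_aut_linear fA 1 a b; rewrite !scale1r. Qed.

Lemma aut0 : f 0 = 0.
Proof. by apply: (addrI (f 0)); rewrite -autD !addr0. Qed.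

Lemma autZ (k : R[i]) a : f (k *: a) = k *: f a.
Proof. by have := star_aut_linear fA k a 0; rewrite aut0 !addr0. Qed.

Lemma autB a b : f (a - b) = f a - f b.
Proof. by rewrite autD -scaleN1r autZ scaleN1r. Qed.

Lemma aut1 : f 1 = 1.
Proof.
have [g _ gK] := star_aut_bij fA.
by rewrite -[LHS]mulr1 -{2}(gK 1) -autM mul1r gK.
Qed.

Lemma aut_unitary v : Defs.is_unitary v -> Defs.is_unitary (f v).
Proof. by case=> uu uv; split; rewrite -aut_star -autM ?uu ?uv aut1. Qed.

Lemma aut_inverse : exists2 g, is_star_aut g & cancel f g /\ cancel g f.
Proof.
have [g fK gK] := star_aut_bij fA; exists g => //.
have inj := can_inj fK.
split=> [k a b|a b|a|]; last by exists f.
- by apply: inj; rewrite gK autD autZ !gK.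
- by apply: inj; rewrite gK autM !gK.
- by apply: inj; rewrite gK aut_star gK.
Qed.

Lemma star_aut_id : is_star_aut (idfun : vn_elt M -> vn_elt M).
Proof. by split => //; exists idfun. Qed.

End StarAutTheory.

(** * Fixed points of the unitary action *)

Section Intertwiner.
Variables (R : realType) (H : hilbertType R) (M : vnAlgebra H).
Implicit Types (a b c v y : vn_elt M).

Lemma star_i a : star ('i%C *: a) = - ('i%C *: star a).
Proof.
rewrite starZ -scaleNr; congr (_ *: _).
by apply/eqP; rewrite eq_complex /= oppr0 !eqxx.
Qed.

Lemma mul_ii a b : ('i%C *: a) * ('i%C *: b) = - (a * b).
Proof.
rewrite -scalerAl -scalerAr scalerA -[RHS]scaleN1r; congr (_ *: _).
by apply/eqP; rewrite eq_complex /=; apply/andP; split; apply/eqP; ring.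
Qed.

Lemma unitary_of_cos_sin a b : star a = a -> star b = b -> a * b = b * a ->
  a * a + b * b = 1 -> Defs.is_unitary (a + 'i%C *: b).
Proof.
move=> sa sb ab ab1.
have key c d : star c = c -> star d = d -> c * d = d * c -> c * c + d * d = 1 ->
    (c - 'i%C *: d) * (c + 'i%C *: d) = 1.
  move=> sc sd cd cd1; rewrite mulrBl !mulrDr mul_ii -scalerAl -scalerAr cd.
  by rewrite opprD opprK addrA addrK.
rewrite /Defs.is_unitary starD star_i sa sb; split; first exact: key.
have := key a (- b); rewrite scalerN opprK; apply => //.
- by rewrite starN sb.
- by rewrite mulrN mulNr ab.
- by rewrite mulrNN.
Qed.

(** The elements [a] with [f a * y = y * a] form an algebra closed under
    inverses, so it is enough to write a self-adjoint [h] in terms of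
    unitaries.  The Cayley transform does it without square roots: for
    [g = res (h * h)], the elements [A = 1 - 2 g] and [B = 2 h g] satisfy
    [A ^ 2 + B ^ 2 = 1], so [A + i B] and [A - i B] are unitary; they yield
    [g], [h g], then [1 + h * h], which is inverse to [g], and finally
    [h = (h g) (1 + h * h)]. *)
Lemma intertwines_all (f : vn_elt M -> vn_elt M) (fA : is_star_aut f) y :
  (forall v, Defs.is_unitary v -> f v * y = y * v) -> forall a, f a * y = y * a.
Proof.
move=> fu.
have lin (k : R[i]) a b : f a * y = y * a -> f b * y = y * b ->
    f (k *: a + b) * y = y * (k *: a + b).
  move=> ha hb.
  by rewrite (autD fA) (autZ fA) mulrDl mulrDr -scalerAl -scalerAr ha hb.
have int1 : f 1 * y = y * 1 by rewrite (aut1 fA) mul1r mulr1.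
have scale (k : R[i]) a : f a * y = y * a -> f (k *: a) * y = y * (k *: a).
  by move=> ha; rewrite (autZ fA) -scalerAl -scalerAr ha.
have cancel (k : R[i]) a : k != 0 -> f (k *: a) * y = y * (k *: a) ->
    f a * y = y * a.
  by move=> k0 /(scale k^-1); rewrite scalerA mulVf// scale1r.
have two0 : (2 : R[i]) != 0 by rewrite pnatr_eq0.
have sa_case h : star h = h -> f h * y = y * h.
  move=> sh; pose s := h * h.
  have s0 : op_ge0 s by rewrite /s -{1}sh; exact: op_ge0_sq.
  pose g := res s; have sg : star g = g by apply/op_ge0_star/res_ge0.
  have [gA Ag] := resP s0; rewrite -/g in gA Ag.
  have Ah : (1 + s) * h = h * (1 + s).
    by rewrite mulrDl mulrDr mul1r mulr1 /s mulrA.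
  have hg : h * g = g * h.
    rewrite -[LHS]mul1r -gA -mulrA [_ * (h * g)]mulrA Ah -[h * _ * g]mulrA Ag.
    by rewrite mulr1.
  pose A := 1 - 2 *: g; pose B := 2 *: (h * g).
  have star2 a : star ((2 : R[i]) *: a) = 2 *: star a.
    rewrite starZ; congr (_ *: _).
    by apply/eqP; rewrite eq_complex /=; apply/andP; split; apply/eqP; ring.
  have sB : star B = B by rewrite /B star2 starM sg sh hg.
  have sA : star A = A by rewrite /A starB star2 sg star1.
  have AB : A * B = B * A.
    have gB : g * B = B * g by rewrite /B -scalerAr -scalerAl mulrA -hg.
    move: (B) gB => b gb.
    by rewrite /A mulrBl mulrBr mul1r mulr1 -scalerAl -scalerAr gb.
  have AB1 : A * A + B * B = 1.
    have BB : h * g * (h * g) = g - g * g.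
      rewrite mulrA -[h * g * h]mulrA -hg mulrA -/s.
      by have [-> _] := res_mul s0; rewrite -/g mulrBl mul1r.
    rewrite /A /B mulrBl !mulrBr mul1r mulr1 -!scalerAl -!scalerAr !scalerA BB.
    have g4 : (2 * 2 : R[i]) *: g = 2 *: g + 2 *: g.
      by rewrite -scalerDl; congr (_ *: _); ring.
    rewrite mul1r scalerBr g4. 
    by rewrite [2 *: g + _ - _]addrAC addrA subrK subrK.
  have U1 := fu _ (unitary_of_cos_sin sA sB AB AB1).
  have U2 : f (A - 'i%C *: B) * y = y * (A - 'i%C *: B).
    rewrite -scalerN; apply: fu; apply: unitary_of_cos_sin => //.
    - by rewrite starN sB.
    - by rewrite mulrN mulNr AB.
    - by rewrite mulrNN.
  have intA : f A * y = y * A.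
    apply: (cancel 2) => //; have := lin 1 _ _ U1 U2.
    have -> // : 1 *: (A + 'i%C *: B) + (A - 'i%C *: B) = 2 *: A.
    by rewrite scale1r addrACA subrr addr0 -mulr2n -scaler_nat.
  have intg : f g * y = y * g.
    apply: (cancel 2) => //; have := lin (-1) _ _ intA int1.
    have -> // : -1 *: A + 1 = 2 *: g.
    by rewrite scaleN1r /A opprB subrK.
  have intB : f (h * g) * y = y * (h * g).
    apply: (cancel 2) => //; apply: (cancel 'i%C).
      by rewrite eq_complex /= oner_eq0 andbF.
    have := lin (-1) _ _ intA U1.
    have -> // : -1 *: A + (A + 'i%C *: B) = 'i%C *: B.
    by rewrite scaleN1r addrA addNr add0r.
  have ints : f (1 + s) * y = y * (1 + s).
    move: (1 + s) gA Ag => X gX Xg.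
    rewrite -[LHS]mulr1 -gX -mulrA [y * _]mulrA -intg !mulrA.
    by rewrite -(autM fA) Xg (aut1 fA) mul1r.
  have hE : h = (h * g) * (1 + s) by rewrite -mulrA gA mulr1.
  rewrite hE (autM fA) -mulrA ints mulrA intB.
  by rewrite [RHS]mulrA.
move=> a.
pose h := a + star a; pose k := 'i%C *: (a - star a).
have sh : star h = h by rewrite /h starD starK addrC.
have sk : star k = k by rewrite /k star_i starB starK -scalerN opprB.
have -> : a = 2^-1 *: (- 'i%C *: k + h).
  rewrite /k /h scalerA (_ : - 'i%C * 'i%C = 1).
    rewrite scale1r [a + star a]addrC addrA subrK -mulr2n -[a *+ 2]scaler_nat.
    by rewrite scalerA mulVf// scale1r.
  by apply/eqP; rewrite eq_complex /=; apply/andP; split; apply/eqP; ring.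
by apply: scale; apply: lin; apply: sa_case.
Qed.

Variable t : ntrace M.

(** By the parallelogram law two near minimizers of [sq2] on a midpoint-convex
    set are close, since their midpoint is no smaller than the infimum.  The
    rate [16 ^ - n] is the one that [bounded_sq2_complete] asks for. *)
Lemma midpoint_minimizer (C : set (vn_elt M)) (K : R) : C !=set0 ->
  (forall c, C c -> sq_bounded K c) ->
  (forall a b, C a -> C b -> C (2^-1%:C%C *: (a + b))) ->
  exists (m : R) (c : nat -> vn_elt M) y,
    [/\ forall n, C (c n), forall n, sq2 t (c n) <= m + 16^-1 ^+ n,
     forall a b e, C a -> C b -> sq2 t a <= m + e -> sq2 t b <= m + e ->
       sq2 t (a - b) <= 4 * e &
     sq2 t (y - c n) @[n --> \oo] --> (0 : R)].
Proof.
move=> [c0 Cc0] CK Cmid; pose S := [set sq2 t c | c in C].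
have Slb : has_lbound S by exists 0 => _ [c _ <-]; exact: sq2_ge0.
have Sinf : has_inf S by split => //; exists (sq2 t c0); exists c0.
pose m := inf S.
have mle c : C c -> m <= sq2 t c by move=> Cc; apply: ge_inf => //; exists c.
have /choice[c cP] : forall n, exists c, C c /\ sq2 t c <= m + 16^-1 ^+ n.
  move=> n; have e0 : 0 < (16^-1 : R) ^+ n by rewrite exprn_gt0.
  have [_ [c Cc <-] h] := inf_adherent e0 Sinf.
  by exists c; split => //; exact: ltW.
have close a b e : C a -> C b -> sq2 t a <= m + e -> sq2 t b <= m + e ->
    sq2 t (a - b) <= 4 * e.
  move=> Ca Cb ha hb; have := mle _ (Cmid _ _ Ca Cb).
  by rewrite sq2Z; have := sq2_parallelogram t a b; lra.
have [y yc] : exists y, sq2 t (y - c n) @[n --> \oo] --> (0 : R).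
  apply: (@bounded_sq2_complete _ _ _ _ _ K 4) => n.
    by apply: CK; have [] := cP n.
  have [Cn cn] := cP n; have [Cn' cn'] := cP n.+1.
  apply: close => //; apply: (le_trans cn'); rewrite lerD2l exprS.
  have : 0 < (16^-1 : R) ^+ n by rewrite exprn_gt0.
  lra.
by exists m, c, y; split => // n; have [] := cP n.
Qed.

(** The action [c |-> f v * c * star v] preserves [sq2], so it moves the
    minimizing sequence [c n] to another one, which is close to it: the limit
    [y] is a fixed point of every unitary [v]. *)
Lemma invariant_set_intertwiner (f : vn_elt M -> vn_elt M) (fA : is_star_aut f)
    (C : set (vn_elt M)) (K : R) : C !=set0 ->
  (forall c, C c -> sq_bounded K c) ->
  (forall a b, C a -> C b -> C (2^-1%:C%C *: (a + b))) ->
  (forall v c, Defs.is_unitary v -> C c -> C (f v * c * star v)) ->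
  exists y (c : nat -> vn_elt M),
    [/\ forall a, f a * y = y * a, forall n, C (c n) &
        sq2 t (y - c n) @[n --> \oo] --> (0 : R)].
Proof.
move=> C0 CK Cmid Cinv.
have [m [c [y [Cc cm close yc]]]] := midpoint_minimizer C0 CK Cmid.
exists y, c; split => //; apply: (intertwines_all fA) => v vU.
have [vv vv'] := vU; have [fvv fvv'] := aut_unitary fA vU.
have conjq a : sq2 t (f v * a * star v) = sq2 t a.
  by rewrite sq2_unitr ?starK// sq2_unitl.
suff yv : f v * y * star v - y = 0.
  by rewrite -[f v * y]mulr1 -vv mulrA (subr0_eq yv).
apply: (sq2_eq0 (t := t)); apply/eqP; rewrite eq_le sq2_ge0 andbT.
have lim0 : 4 * sq2 t (y - c n) + 16 * 16^-1 ^+ n + 4 * sq2 t (y - c n)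
    @[n --> \oo] --> (0 : R).
  apply: cvg0D; last exact: cvg0M.
  apply: cvg0D; first exact: cvg0M.
  by apply: cvg0_geometric; apply/andP; split; lra.
apply: (cvgr_to_ge lim0); apply: nearW => n /=.
set z := f v * c n * star v.
have -> : f v * y * star v - y =
    (f v * (y - c n) * star v) + ((z - c n) - (y - c n)).
  by rewrite mulrBr mulrBl -/z opprB !addrA !subrK.
have h1 := sq2D_le t (f v * (y - c n) * star v) (z - c n - (y - c n)).
have h2 := sq2B_le t (z - c n) (y - c n).
have h3 : sq2 t (z - c n) <= 4 * 16^-1 ^+ n.
  by apply: close => //; [exact: Cinv | rewrite conjq].
rewrite conjq in h1; have := sq2_ge0 t (y - c n); lra.
Qed.

End Intertwiner.

(** * Automorphisms preserve order, norm and trace *)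

Section AutomorphismPositivity.
Variables (R : realType) (H : hilbertType R) (M : vnAlgebra H).
Variables (f : vn_elt M -> vn_elt M) (fA : is_star_aut f).
Implicit Types (a b c v y : vn_elt M).

(** Let [h = f s] and let [k] be the least scalar [>= 0] such that [k + h] is
    positive.  If [k > 0], then [k + s] is invertible, hence so is
    [p = k + h]; a positive invertible [p] is bounded below by some [e > 0], so
    [k - e] would do as well. *)
Lemma aut_ge0 s : op_ge0 s -> op_ge0 (f s).
Proof.
move=> s0; set h := f s.
have sh : star h = h by rewrite /h -(aut_star fA) op_ge0_star.
pose T := [set k : R | 0 <= k /\ op_ge0 (k%:C%C%:A + h)].
have [L L0 hL] := op_lower_bound h.
have TL : T L by split; [exact: ltW | exact/op_ge0_add_scalar].
have Tinf : has_inf T by split; [exists L | exists 0 => k []].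
have t0 : 0 <= inf T by apply: lb_le_inf; [exists L | move=> k []].
have Tt0 : T (inf T).
  split => //; apply/op_ge0_add_scalar => // x.
  have n0 := sqn_ge0 x; apply/ler_addgt0Pr => e e0.
  have e1 : 0 < e / (sqn x + 1) by rewrite divr_gt0// ltr_wpDl.
  have [k [k0 /op_ge0_add_scalar-/(_ sh x) kh] kinf] := inf_adherent e1 Tinf.
  have : k * sqn x <= (inf T + e / (sqn x + 1)) * sqn x.
    by rewrite ler_wpM2r// ltW.
  have : e / (sqn x + 1) * sqn x <= e.
    by rewrite mulrAC ler_pdivrMr ?ltr_wpDl// ler_pM2l// lerDl.
  lra.
have [t00|t0'] := eqVneq (inf T) 0.
  by have [_] := Tt0; rewrite t00 scale0r add0r.
have {t0'} t0' : 0 < inf T by rewrite lt_def t0'.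
have [b bs] := scalar_add_invertible t0' s0.
set p := (inf T)%:C%C%:A + h in Tt0.
(* f b inverts p, so that sqn x is controlled by sqn (p x), which is in
   turn controlled by the form of p. *)
have fbp : f b * p = 1.
  by rewrite -(aut1 fA) -bs (autM fA) (autD fA) (autZ fA) (aut1 fA).
have [K1 K10 pK1] := op_ge0_sqn Tt0.2.
have [K2 K20 bK2] := vn_bounded (f b).
pose e := ((K2 + 1) * K1)^-1.
have e0 : 0 < e by rewrite invr_gt0 mulr_gt0//; lra.
have pe x : e * sqn x <= rdot (p x) x.
  rewrite ler_pdivrMl ?mulr_gt0//; last by lra.
  have := bK2 (p x); rewrite -vnM fbp vn1 => h1; apply: (le_trans h1).
  apply: (@le_trans _ _ ((K2 + 1) * sqn (p x))).
    by rewrite ler_wpM2r ?sqn_ge0//; lra.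
  by rewrite -mulrA ler_wpM2l//; lra.
have : inf T <= Num.max 0 (inf T - e).
  apply: ge_inf; first by case: Tinf.
  split; first by rewrite le_max lexx.
  apply/op_ge0_add_scalar => // x; have := pe x.
  rewrite vnD vnZ vn1 rdotDl rdotZl -/(sqn x) => h1.
  have n0 := sqn_ge0 x.
  have : (inf T - e) * sqn x <= Num.max 0 (inf T - e) * sqn x.
    by rewrite ler_wpM2r// le_max lexx orbT.
  lra.
by rewrite le_max; lra.
Qed.

Lemma aut_le a b : op_le a b -> op_le (f a) (f b).
Proof. by rewrite /op_le -(autB fA); exact: aut_ge0. Qed.

End AutomorphismPositivity.

Section TraceInvariance.
Variables (R : realType) (H : hilbertType R) (M : vnAlgebra H).
Variables (f : vn_elt M -> vn_elt M) (fA : is_star_aut f).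
Implicit Types (a b c v y : vn_elt M).

Lemma aut_sq_bounded (K : R) a : sq_bounded K a -> sq_bounded K (f a).
Proof.
move=> /sq_boundedP/(aut_le fA); rewrite (autZ fA) (aut1 fA) (autM fA).
by rewrite (aut_star fA) => /sq_boundedP.
Qed.

Lemma aut_lub (D : nat -> vn_elt M) l :
  op_is_lub (range D) l -> op_is_lub (range (f \o D)) (f l).
Proof.
move=> [up least]; have [g gA [fK gK]] := aut_inverse fA.
split=> [_ [n _ <-]|u uP]; first by apply: (aut_le fA); apply: up; exists n.
rewrite -(gK u); apply: (aut_le fA); apply: least => _ [n _ <-].
by rewrite -[D n]fK; apply: (aut_le gA); apply: uP; exists n.
Qed.

Lemma ntrace_comp_aut (t : ntrace M) :
  exists t' : ntrace M, forall a, t' a = t (f a).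
Proof.
have [g gA [fK gK]] := aut_inverse fA.
have fD a b : t (f (a + b)) = t (f a) + t (f b) by rewrite (autD fA) ntD.
have fZ (k : R) a : t (f (k%:C%C *: a)) = k * t (f a) by rewrite (autZ fA) ntZ.
have f0 a : op_ge0 a -> 0 <= t (f a) by move=> a0; exact/nt_ge0/aut_ge0.
have fC a b : t (f (a * b)) = t (f (b * a)) by rewrite !(autM fA) ntC.
have fS a : t (f (star a)) = t (f a) by rewrite (aut_star fA) nt_star.
have fF a : op_ge0 a -> t (f a) = 0 -> a = 0.
  move=> a0 /(nt_faithful (aut_ge0 fA a0)) fa0.
  by rewrite -[a]fK fa0 (aut0 gA).
have fN (a : nat -> vn_elt M) l : (forall n, op_ge0 (a n)) ->
    (forall n, op_le (a n) (a n.+1)) -> op_is_lub (range a) l ->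
    t (f (a n)) @[n --> \oo] --> t (f l).
  move=> a0 aS al; have := @nt_normal _ _ _ t (f \o a) (f l).
  apply; last exact: aut_lub.
  - by move=> n; exact: aut_ge0.
  - by move=> n; exact: aut_le.
by exists (@NTrace _ _ M (fun a => t (f a)) fD fZ f0 fC fS fF fN).
Qed.

Lemma ntrace_add (t1 t2 : ntrace M) :
  exists t' : ntrace M, forall a, t' a = t1 a + t2 a.
Proof.
have fD a b : t1 (a + b) + t2 (a + b) = (t1 a + t2 a) + (t1 b + t2 b).
  by rewrite !ntD addrACA.
have fZ (k : R) a : t1 (k%:C%C *: a) + t2 (k%:C%C *: a) = k * (t1 a + t2 a).
  by rewrite !ntZ mulrDr.
have f0 a : op_ge0 a -> 0 <= t1 a + t2 a.
  by move=> a0; rewrite addr_ge0// nt_ge0.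
have fC a b : t1 (a * b) + t2 (a * b) = t1 (b * a) + t2 (b * a).
  by rewrite ntC [t2 _]ntC.
have fS a : t1 (star a) + t2 (star a) = t1 a + t2 a by rewrite !nt_star.
have fF a : op_ge0 a -> t1 a + t2 a = 0 -> a = 0.
  move=> a0 e; apply: (nt_faithful (n := t1) a0); have := nt_ge0 t1 a0.
  have := nt_ge0 t2 a0; lra.
have fN (a : nat -> vn_elt M) l : (forall n, op_ge0 (a n)) ->
    (forall n, op_le (a n) (a n.+1)) -> op_is_lub (range a) l ->
    t1 (a n) + t2 (a n) @[n --> \oo] --> t1 l + t2 l.
  by move=> a0 aS al; apply: cvgD; exact: nt_normal.
by exists (@NTrace _ _ M (fun a => t1 a + t2 a) fD fZ f0 fC fS fF fN).
Qed.

(** Both [t] and [t o f] are constant on the set [C], which is invariant under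
    conjugation by unitaries; the fixed point obtained for [t + t o f] is
    central, hence a scalar, hence fixed by [f]. *)
Theorem trace_aut_invariant (t : ntrace M) x : is_factor M -> t (f x) = t x.
Proof.
move=> factor; have [t' t'E] := ntrace_comp_aut t.
have [s sE] := ntrace_add t t'.
have [K K0 xK] := vn_bounded x.
pose C := [set c : vn_elt M | [/\ sq_bounded K c, t c = t x & t' c = t' x]].
have [|c []//|a b [aK ta t'a] [bK tb t'b]|v c vU [cK tc t'c]|y [c [yc Cc lim]]]
    :=
    @invariant_set_intertwiner _ _ _ s _ (@star_aut_id _ _ M) C K.
- by exists x.
- split; first exact: sq_bounded_midpoint.
  + by rewrite ntZ ntD ta tb; lra.
  + by rewrite ntZ ntD t'a t'b; lra.
- have [vv _] := vU; split; first exact: sq_bounded_conj.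
  + by rewrite ntC mulrA vv mul1r.
  + by rewrite ntC mulrA vv mul1r.
have [|k yE] := factor y; first by move=> a; rewrite -yc.
have same (r : ntrace M) : (forall a, op_ge0 a -> r a <= s a) ->
    (forall n, r (c n) = r x) -> r y = r x.
  move=> rs rc; apply/subr0_eq/eqP; rewrite -sqrf_eq0 eq_le sqr_ge0 andbT.
  apply: (cvgr_to_ge (cvg0M (r 1) lim)); apply: nearW => n /=.
  rewrite -(rc n) -ntB; apply: (le_trans (nt_sq_le r _)).
  rewrite ler_wpM2l ?nt_ge0//; first exact: op_ge0_one.
  exact/rs/op_ge0_sq.
have ty : t y = t x.
  apply: same => [a a0|n]; last by have [] := Cc n.
  by rewrite sE lerDl nt_ge0.
have t'y : t' y = t' x.
  apply: same => [a a0|n]; last by have [] := Cc n.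
  by rewrite sE lerDr nt_ge0.
rewrite -t'E -t'y -ty t'E yE (autZ fA) (aut1 fA)//.
Qed.

End TraceInvariance.

(** * The real part of a tracial state *)

Section TraceOfFactor.
Variables (R : realType) (H : hilbertType R) (M : vnAlgebra H).
Variables (tau : tracial_state M).
Implicit Types (a b c v y : vn_elt M).

Lemma traceD a b : tau (a + b) = tau a + tau b.
Proof. by have := tr_linear tau 1 a b; rewrite scale1r mul1r. Qed.

Lemma trace0 : tau 0 = 0.
Proof. by apply: (addrI (tau 0)); rewrite -traceD !addr0. Qed.

Lemma traceZ (k : R[i]) a : tau (k *: a) = k * tau a.
Proof. by have := tr_linear tau k a 0; rewrite trace0 !addr0. Qed.

(** [L + a] is positive for large [L]. *)
Lemma trace_self_adjoint_real a : star a = a -> complex.Im (tau a) = 0.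
Proof.
move=> sa; have [L L0 aL] := op_lower_bound a.
have /(tr_ge0 tau) : op_ge0 (L%:C%C%:A + a) by apply/op_ge0_add_scalar.
rewrite traceD traceZ tr1 mulr1; case: (tau a) => u v.
by rewrite lecE/= add0r => /andP[/eqP].
Qed.

(** Apply the reality of [tau] on self-adjoint elements to [i (a - star a)]. *)
Lemma Re_trace_star a : complex.Re (tau (star a)) = complex.Re (tau a).
Proof.
have sd : star ('i%C *: (a - star a)) = 'i%C *: (a - star a).
  by rewrite star_i starB starK -scalerN opprB.
have := trace_self_adjoint_real sd; rewrite traceZ -scaleN1r traceD traceZ.
by case: (tau a) => u v; case: (tau (star a)) => u' v' /=; lra.
Qed.

Lemma ntrace_of_tracial_state : faithful tau -> normal tau ->
  exists t : ntrace M, forall a, t a = complex.Re (tau a).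
Proof.
move=> tauF tauN.
have fD a b :
    complex.Re (tau (a + b)) = complex.Re (tau a) + complex.Re (tau b).
  by rewrite traceD raddfD.
have fZ (k : R) a : complex.Re (tau (k%:C%C *: a)) = k * complex.Re (tau a).
  by rewrite traceZ; case: (tau a) => u v /=; rewrite mul0r subr0.
have f0 a : op_ge0 a -> 0 <= complex.Re (tau a).
  by move=> /(tr_ge0 tau); rewrite lecE => /andP[].
have fC a b : complex.Re (tau (a * b)) = complex.Re (tau (b * a)).
  by rewrite trC.
have fF a : op_ge0 a -> complex.Re (tau a) = 0 -> a = 0.
  move=> a0 e; apply: tauF => //.
  have := trace_self_adjoint_real (op_ge0_star a0).
  by case: (tau a) e => u v /= -> ->.
have fN (a : nat -> vn_elt M) l : (forall n, op_ge0 (a n)) ->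
    (forall n, op_le (a n) (a n.+1)) -> op_is_lub (range a) l ->
    complex.Re (tau (a n)) @[n --> \oo] --> complex.Re (tau l).
  move=> a0 aS al; have mono := op_le_homo aS.
  rewrite (tauN (range a) l) //; first last.
  - split; first by exists (a 0%N), 0%N.
    move=> _ _ [m _ <-] [n _ <-].
    exists (a (maxn m n)); first by exists (maxn m n).
    by split; apply: mono; rewrite ?leq_maxl ?leq_maxr.
  - by move=> _ [n _ <-].
  have -> : [set complex.Re (tau b) | b in range a] =
      range (fun n => complex.Re (tau (a n))).
    by rewrite image_comp.
  have le b c : op_le b c -> complex.Re (tau b) <= complex.Re (tau c).
    by move=> /f0; rewrite -scaleN1r traceD traceZ mulN1r raddfB/= subr_ge0.
  apply: nondecreasing_cvgn => [m n mn|]; first exact/le/mono.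
  by exists (complex.Re (tau l)) => _ [n _ <-]; apply/le/al.1; exists n.
by exists (@NTrace _ _ M (fun a => complex.Re (tau a))
  fD fZ f0 fC Re_trace_star fF fN).
Qed.

End TraceOfFactor.

(** * Quotients and bounded sequences *)

Section StarQuotientTheory.
Variables (C : numClosedFieldType) (A : starAlgType C) (I : starIdeal A).

Lemma squot_eqP (x y : A) :
  \pi_(star_quot I) x = \pi_(star_quot I) y <-> I (x - y).
Proof. by split=> [/eqP/star_quotP|/star_quotP/eqP]. Qed.

Lemma repr_squot (x : A) : I (repr (\pi_(star_quot I) x) - x).
Proof. by apply/squot_eqP; rewrite reprK. Qed.

Lemma squotM (x y : A) :
  \pi_(star_quot I) x * \pi_(star_quot I) y = \pi_(star_quot I) (x * y).
Proof.
apply/squot_eqP; set x' := repr _; set y' := repr _.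
have -> : x' * y' - x * y = (x' - x) * y' + x * (y' - y).
  by rewrite mulrBl mulrBr addrA subrK.
by apply: sidealD; [apply: sidealMr | apply: sidealMl]; exact: repr_squot.
Qed.

Lemma squot_star_pi (x : A) :
  star (\pi_(star_quot I) x) = \pi_(star_quot I) (star x).
Proof.
apply/squot_eqP; rewrite -starB; apply: sideal_star; exact: repr_squot.
Qed.

End StarQuotientTheory.

Section BoundedSequenceTheory.
Variables (R : realType) (H : hilbertType R) (M : vnAlgebra H).

Lemma linf_sq_bounded (x : linf M) : exists K : R, forall n, sq_bounded K (x n).
Proof.
have [[k k'] ] := linf_bounded x; rewrite ltcE/= => /andP[/eqP -> k0] xk.
exists (k ^+ 2) => n v; have : `|x n v| ^+ 2 <= (k%:C%C * `|v|) ^+ 2.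
  by apply: lerXn2r (xk n v); rewrite nnegrE// mulr_ge0// lecR ltW.
by rewrite exprMn !norm_sqn -rmorphXn/= -rmorphM/= lecR.
Qed.

Lemma linf_of_sq_bounded (x : nat -> vn_elt M) (K : R) :
  (forall n, sq_bounded K (x n)) -> exists X : linf M, forall n, X n = x n.
Proof.
move=> xK; have xb : x \in linf_pred (M := M).
  apply/asboolP; exists (Num.sqrt `|K|)%:C%C => n v.
  rewrite -(ler_pXn2r (_ : 0 < 2)%N)// ?nnegrE//; last first.
    by rewrite mulr_ge0// lecR sqrtr_ge0.
  rewrite exprMn !norm_sqn -rmorphXn/= -rmorphM/= lecR sqr_sqrtr//.
  by rewrite (le_trans (xK n v))// ler_wpM2r ?sqn_ge0// ler_norm.
by exists (Linf xb).
Qed.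

End BoundedSequenceTheory.

(** * From the ultrapower to a uniform approximate intertwiner *)

Section ApproximateImplementation.
Variables (R : realType) (H : hilbertType R) (M : vnAlgebra H).
Variables (tau : tracial_state M) (t : ntrace M).
Hypothesis tE : forall a, t a = complex.Re (tau a).
Variables (omega : set_system nat) (Uomega : UltraFilter omega).
Implicit Types (a b c u v y : vn_elt M).
Local Notation I := (null_ideal tau Uomega).
Local Notation pi := (\pi_(star_quot I)).

Lemma null_idealP (x : linf M) :
  I x <-> sq2 t (x n) @[n --> omega] --> (0 : R).
Proof.
rewrite (_ : (fun n => sq2 t (x n)) =
  fun n => complex.Re (tau (star (x n) * x n))); first exact: norm2_cvg0.
by apply/funext => n; rewrite /sq2 tE.
Qed.

Lemma null_near (x : linf M) (e : R) : 0 < e -> I x ->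
  \forall n \near omega, sq2 t (x n) < e.
Proof.
move=> e0 /null_idealP/cvgrPdist_lt/(_ e e0); apply: filterS => n.
by rewrite sub0r normrN ger0_norm// sq2_ge0.
Qed.

Variables (theta : vn_elt M -> vn_elt M) (thetaA : is_star_aut theta).
Hypothesis factor : is_factor M.

Lemma theta_linf (x : linf M) : exists X : linf M, forall n, X n = theta (x n).
Proof.
have [K xK] := linf_sq_bounded x; apply: (@linf_of_sq_bounded _ _ _ _ K) => n.
exact: aut_sq_bounded.
Qed.

Lemma theta_null (x X : linf M) : (forall n, X n = theta (x n)) -> I x -> I X.
Proof.
move=> Xx /null_idealP x0; apply/null_idealP.
rewrite (_ : (fun n => _) = fun n => sq2 t (x n))//; apply/funext => n.
by rewrite Xx /sq2 -(aut_star thetaA) -(autM thetaA) trace_aut_invariant.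
Qed.

(** The representative chosen in [ultrapower_map] does not matter: [theta]
    preserves bounded sequences and, because it preserves the trace, null
    sequences. *)
Lemma ultrapower_map_pi (x X : linf M) : (forall n, X n = theta (x n)) ->
  ultrapower_map theta (pi x) = pi X.
Proof.
move=> Xx; rewrite /ultrapower_map.
have [Z ZE] := theta_linf (repr (pi x)).
have -> : insubd (0 : linf M) (fun n => theta (repr (pi x) n)) = Z.
  rewrite (_ : (fun n => _) = val Z); first exact: valKd.
  by apply/funext => n; rewrite -ZE.
apply/squot_eqP; apply: (@theta_null (repr (pi x) - x)); last exact: repr_squot.
move=> n; rewrite (_ : (Z - X) n = Z n - X n)// ZE Xx -(autB thetaA) //.
Qed.

(** At each index [n] choose [v n] violating the estimate whenever some unitary
    does.  The sequence [v] satisfies it for [omega]-almost all [n], and at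
    such an [n] no unitary can violate it.  Unitarity of the class of [u n]
    gives [q (star u * u - 1) < 1/4], hence [(q u - 1) ^ 2 < 1/4]. *)
Lemma approximate_intertwiner :
  is_inner (ultrapower_map theta : star_quot I -> star_quot I) ->
  exists u, 2^-1 < sq2 t u /\
    forall v, Defs.is_unitary v -> sq2 t (theta v * u - u * v) <= 4^-1.
Proof.
move=> [U [UU _] Uinner]; pose u := repr U.
have Upi : U = pi u by rewrite /u reprK.
have uu : I (star u * u - 1).
  by apply/squot_eqP; rewrite -squotM -squot_star_pi -Upi.
have intertwine (x X : linf M) : (forall n, X n = theta (x n)) ->
    I (X * u - u * x).
  move=> Xx; apply/squot_eqP; rewrite -!squotM -(ultrapower_map_pi Xx) Uinner.
  by rewrite -Upi -[LHS]mulrA UU mulr1.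
have choice_v n : exists v, Defs.is_unitary v /\
    ((exists2 w, Defs.is_unitary w & 4^-1 < sq2 t (theta w * u n - u n * w)) ->
     4^-1 < sq2 t (theta v * u n - u n * v)).
  have [[w wU wbad]|no] := pselect (exists2 w, Defs.is_unitary w &
    4^-1 < sq2 t (theta w * u n - u n * w)); first by exists w.
  by exists 1; split => //; split; rewrite star1 mulr1.
have /choice[v vP] := choice_v.
have vb n : sq_bounded 1 (v n).
  by move=> x; rewrite mul1r unitary_sqn//; have [] := vP n.
have [V VE] := linf_of_sq_bounded vb.
have [X XE] := theta_linf V.
have q0 : 0 < (4^-1 : R) by rewrite invr_gt0.
(* Indices at which v n satisfies the estimate, and at which u n is nearly
   an isometry. *)
have near1 := null_near q0 (intertwine _ _ XE).
have near2 := null_near q0 uu.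
have t1 : t 1 = 1 by rewrite tE tr1.
have [n [n1 n2]] := filter_ex (filterI near1 near2).
exists (u n); split.
  have := nt_sq_le t ((star u * u - 1) n); rewrite t1 mul1r.
  rewrite (_ : (star u * u - 1) n = star (u n) * u n - 1)// in n2 *.
  rewrite ntB t1 -/(sq2 t (u n)); move: n2.
  set p := sq2 t (_ - 1); set q := sq2 t _.
  nra.
move=> w wU; rewrite leNgt; apply/negP => bad.
have [_ vbad] := vP n.
have {}vbad := vbad (ex_intro2 _ _ w wU bad).
move: n1; rewrite (_ : (X * u - u * V) n = theta (v n) * u n - u n * v n).
  by move=> /(lt_trans vbad); rewrite ltxx.
by rewrite -VE -XE.
Qed.

End ApproximateImplementation.

(** * From an approximate to an exact intertwiner *)

Section ExactIntertwiner.
Variables (R : realType) (H : hilbertType R) (M : vnAlgebra H).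
Variables (theta : vn_elt M -> vn_elt M) (thetaA : is_star_aut theta).
Hypothesis factor : is_factor M.
Implicit Types (a b c u v y : vn_elt M).

(** The set [C] consists of the elements that are close in 2-norm to the whole
    orbit of [u]; the hypothesis says exactly that [u] belongs to it.
    Taking [v = 1], a sequence in [C] converging to [0] would give
    [sq2 u <= 2 * 4^-1 + 2 * 0]. *)
Lemma exact_intertwiner (t : ntrace M) u : 2^-1 < sq2 t u ->
  (forall v, Defs.is_unitary v -> sq2 t (theta v * u - u * v) <= 4^-1) ->
  exists2 y, y != 0 & forall a, theta a * y = y * a.
Proof.
move=> u_big u_int; have [K K0 uK] := vn_bounded u.
pose C := [set c : vn_elt M | sq_bounded K c /\
  forall v, Defs.is_unitary v -> sq2 t (c - theta v * u * star v) <= 4^-1].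
have [|c []//|a b [aK aC] [bK bC]|v c vU [cK cC]|y [c [yint Cc lim]]] :=
    @invariant_set_intertwiner _ _ _ t _ thetaA C K.
- exists u; split => // v vU; have [vv vv'] := vU.
  have -> : u - theta v * u * star v = (u * v - theta v * u) * star v.
    by rewrite mulrBl -[u * v * _]mulrA vv' mulr1.
  by rewrite sq2_unitr ?starK// sq2BC u_int.
- split=> [|v vU]; first exact: sq_bounded_midpoint.
  set z := theta v * u * star v.
  have -> : 2^-1%:C%C *: (a + b) - z = 2^-1%:C%C *: ((a - z) + (b - z)).
    have half : 2^-1%:C%C *: (z + z) = z.
      have e : (2^-1 + 2^-1 : R) = 1 by lra.
      by rewrite scalerDr -scalerDl -rmorphD e rmorph1 scale1r.
    by rewrite addrACA -opprD scalerBr half.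
  apply: (le_trans (sq2_midpoint _ _ _)).
  by have := aC v vU; have := bC v vU; rewrite -/z; lra.
- have thv := aut_unitary thetaA vU; have [vv vv'] := vU.
  have [thv1 thv2] := thv.
  split=> [|w wU]; first exact: sq_bounded_conj.
  pose z := star v * w.
  have zU : Defs.is_unitary z.
    have [ww ww'] := wU; rewrite /z; split; rewrite starM starK.
      by rewrite mulrA -[star w * v * _]mulrA vv' mulr1.
    by rewrite mulrA -[star v * w * _]mulrA ww' mulr1.
  have -> : theta v * c * star v - theta w * u * star w =
      theta v * (c - theta z * u * star z) * star v.
    rewrite mulrBr mulrBl /z starM starK (autM thetaA) (aut_star thetaA).
    congr (_ - _); rewrite !mulrA thv2 mul1r -!mulrA vv' mulr1 //.
  by rewrite sq2_unitr ?starK// sq2_unitl//; exact: cC.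
exists y => //; apply/eqP => y0.
have limu : 2^-1 + 2 * sq2 t (c n) @[n --> \oo] --> (2^-1 : R).
  rewrite -[X in _ --> X]addr0; apply: cvgD; first exact: cvg_cst.
  apply: cvg0M; move: lim; rewrite y0.
  by under eq_fun do rewrite sub0r sq2N.
move: u_big; rewrite ltNge => /negP; apply.
apply: (cvgr_to_ge limu); apply: nearW => n.
have [_ /(_ 1)] := Cc n; rewrite (aut1 thetaA) star1 mul1r mulr1 => cu.
have {}cu : sq2 t (c n - u) <= 4^-1 by apply: cu; split; rewrite star1 mulr1.
have := sq2D_le t (u - c n) (c n); rewrite subrK sq2BC; lra.
Qed.

(** [star y * y] commutes with every [a] and [y * star y] with every [theta a],
    so both are scalars; they coincide since [y * star y * y] can be computed
    in two ways, and their common value is positive because [star y * y] is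
    positive and nonzero. *)
Lemma inner_of_intertwiner (y : vn_elt M) : y != 0 ->
  (forall a, theta a * y = y * a) -> is_inner theta.
Proof.
move=> y0 yint.
have yint' a : star y * theta a = a * star y.
  have := yint (star a); rewrite (aut_star thetaA) => /(congr1 (@star _ _)).
  by rewrite !starM !starK.
have [g _ [thK gK]] := aut_inverse thetaA.
have [|k kE] := @factor (star y * y).
  by move=> a; rewrite -mulrA -yint mulrA yint' mulrA.
have [|k' k'E] := @factor (y * star y).
  by move=> a; rewrite -(gK a) -mulrA yint' mulrA -yint mulrA.
have kk' : k = k'.
  have : k *: y = k' *: y.
    by rewrite -[k *: y]mulr_algr -kE mulrA k'E mulr_algl.
  move=> /eqP; rewrite -subr_eq0 -scalerBl scaler_eq0 (negPf y0) orbF subr_eq0.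
  by move/eqP.
have [k0 | kneq0] := eqVneq k 0.
  have yE : y = 0 by apply: op_sq_eq0; rewrite kE k0 scale0r.
  by move: y0; rewrite yE eqxx.
have [r r0 kr] : exists2 r : R, 0 < r & k = r%:C%C.
  have [x x0] := vn_neq0 M.
  have n0 : 0 < sqn x.
    by rewrite lt_def sqn_ge0 andbT; apply/eqP => /sqn_eq0.
  have := op_ge0_sq y x; rewrite kE vnZ vn1 dotZl dot_sqn.
  move: kneq0; case: (k) => u v kneq0.
  rewrite lecE/= !(mulr0, addr0, subr0, add0r) => /andP[].
  rewrite mulf_eq0 (gt_eqF n0) orbF => /eqP v0; rewrite v0 in kneq0 *.
  rewrite pmulr_lge0// => u0; exists u => //.
  by rewrite lt_def u0 andbT; apply: contraNneq kneq0 => ->.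
pose w := (Num.sqrt r)^-1%:C%C *: y.
have rr : (Num.sqrt r)^-1 * (Num.sqrt r)^-1 * r = 1.
  by rewrite -expr2 exprVn sqr_sqrtr ?mulVf ?gt_eqF// ltW.
have norm1 (z : vn_elt M) : z = k%:A ->
    (Num.sqrt r)^-1%:C%C *: ((Num.sqrt r)^-1%:C%C *: z) = 1.
  by move=> ->; rewrite kr !scale_real rr scale1r.
have sw : star w = (Num.sqrt r)^-1%:C%C *: star y by exact: star_scale_real.
have wU : Defs.is_unitary w.
  split; rewrite sw -scalerAl -scalerAr; apply: norm1 => //.
  by rewrite k'E kk'.
exists w => // a; have [_ ww] := wU.
have wint : theta a * w = w * a by rewrite /w -scalerAr yint -scalerAl.
by rewrite -wint -mulrA ww mulr1.
Qed.

End ExactIntertwiner.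

Theorem theorem2p5 (R : realType) (H : hilbertType R) (M : vnAlgebra H)
  (tau : tracial_state M) (M_II1 : is_II1_factor tau)
  (omega : set_system nat) (Uomega : UltraFilter omega)
  (omega_free : forall n : nat, ~ omega [set n])
  (theta : vn_elt M -> vn_elt M) (theta_aut : is_star_aut theta)
  (theta_omega_inner :
     is_inner (ultrapower_map theta : ultrapower tau Uomega -> ultrapower tau Uomega)) :
  is_inner theta.
Proof.
have [factor _ tauF tauN] := M_II1.
have [t tE] := ntrace_of_tracial_state tauF tauN.
have [u [u_big u_int]] :=
  approximate_intertwiner tE theta_aut factor theta_omega_inner.
have [y y0 yint] := exact_intertwiner theta_aut u_big u_int.
exact: (inner_of_intertwiner theta_aut factor y0 yint).
Qed.
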